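(* Let $a\in\mathcal H$ be a real-valued $1$-form with flux depending only on the scale, with associated sequence $(\beta_m)_{m\ge1}$. Then for every $m\ge1$ the operator $-\mathcal M^{a_m}_m$ is spectrally similar to $-\mathcal M^{a_{m-1}}_{m-1}$ via the functions $$\phi_0(z,\beta_m)=\frac{\cos2\beta_m}{2(1-z)},\qquad \phi_1(z,\beta_m)=\frac{-2z^2+4z-1+\cos2\beta_m}{2(1-z)}.$$
   Context: Diamond lattice fractal. Fix $0<s\le 1/8$ and for $j=1,2,3,4$ let $F_j:\mathbb R^2\to\mathbb R^2$, $F_j(x_1,x_2)=\bigl(\tfrac12x_1,\ \tfrac12((-1)^jx_1+4s\,x_2)\bigr)+\tfrac1{\sqrt2}\bigl(\cos((2j-1)\pi/4),\sin((2j-1)\pi/4)\bigr)$. $X\subset\mathbb R^2$ is the unique non-empty compact set with $X=\bigcup_{j=1}^4F_j(X)$. Put $V_0=\{(-1,0),(1,0)\}$, $V_m=\bigcup_jF_j(V_{m-1})$. For a word $w=w_1\cdots w_m\in\{1,2,3,4\}^m$ write $|w|=m$, $F_w=F_{w_1}\circ\cdots\circ F_{w_m}$; $F_w(X)$ is an $m$-cell with indicator function $\mathbf 1_w$. Write $x\sim_my$ if $\{x,y\}=F_w(V_0)$ for some $|w|=m$, and $\deg_m(x)$ for the number of $y$ with $y\sim_mx$. $\mu$ is Hausdorff measure on $X$ scaled so that $\mu(X)=2$. Dirichlet form. $\mathcal E_m(f)=\frac12\sum_{x\in V_m}\sum_{y\sim_mx}|f(x)-f(y)|^2$ is non-decreasing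 in $m$; when the limit is finite write $f\in\mathcal F$ and $\mathcal E(f)=\lim_m\mathcal E_m(f)$, a Dirichlet form on $L^2(X,\mu)$. A function $h$ is harmonic at scale $m$ if $\mathcal E_n(h)=\mathcal E_m(h)$ for all $n\ge m$. $1$-forms. $\mathcal H$ is the Hilbert space of $1$-forms of $\mathcal E$: the completion (modulo null vectors) of the span of $f\otimes g$, $f\in\mathcal F$, $g$ bounded Borel, with $\langle f\otimes g,f'\otimes g'\rangle_{\mathcal H}=\int g\overline{g'}\,d\Gamma(f,f')$, where $\Gamma$ is the energy measure normalized by $\Gamma(f,f)(X)=\mathcal E(f)$; $\partial f=f\otimes\mathbf 1$; $h(f\otimes g)=f\otimes(hg)$. A $1$-form is real-valued if it lies in the closure of the real span of $f\otimes g$ with $f,g$ real-valued. $\mathcal H_m\subset\mathcal H$ is the (finite-dimensional) span of the elements $(\partial A)\mathbf 1_w$ with $|w|=m$ and $A$ harmonic at scale $m$; $a_m$ is the orthogonal projection of $a$ onto $\mathcal H_m$. For real $a$, $a_m=\sum_{|w|=m}(\partial A_w)\mathbf 1_w$ with $A_w$ real-valued, harmonic at scale $m$, unique modulo constants on $F_w(X)$; for $x\sim_my$ with $\{x,y\}=F_w(V_0)$, $|w|=m$, put $a_m(e_{xy})=A_w(y)-A_w(x)$. This identifies real elements of $\mathcal H_m$ with real antisymmetric functions on directed scale-$m$ edges. Flux depending only on the scale. For $|w|=m-1$, $k_w\in\mathcal H_m$ is the form whose edge function equals $1$ on each of the four edges of the directed loop $F_w(-1,0)\to F_w(0,-1)\to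 F_w(1,0)\to F_w(0,1)\to F_w(-1,0)$ (so $-1$ on reversed edges) and $0$ on all other scale-$m$ edges. The field $a$ has flux depending only on the scale if there are $a_0\in\mathcal H_0$ and a real sequence $\beta_m$ with $a_m=a_{m-1}+\beta_m\sum_{|w|=m-1}k_w$ for all $m\ge1$. Graph magnetic operator (here defined at all points of $V_m$, including $V_0$): $\mathcal M^{a_m}_mf(x)=\frac{-1}{\deg_m(x)}\sum_{y\sim_mx}\bigl(f(x)-f(y)e^{ia_m(e_{xy})}\bigr)$, $x\in V_m$, acting on functions on $V_m$ with the inner product weighted by $\deg_m$. Spectral similarity. Bounded operators $M$ on a Hilbert space $\mathcal U$ and $M_0\ne I$ on $\mathcal U_0$, with an isometry $U:\mathcal U_0\to\mathcal U$, are spectrally similar via $\phi_0,\phi_1$ if there is a non-empty open $\Lambda\subset\mathbb C$ on which these functions are defined such that $U^*(M-z)^{-1}U=(\phi_0(z)M_0-\phi_1(z))^{-1}$ for all $z\in\Lambda$. Here $\mathcal U$ is the space of functions on $V_m$, and $\mathcal U_0$ is the space of functions on $V_{m-1}$ regarded as the subspace of functions on $V_m$ vanishing on $V_m\setminus V_{m-1}$ (with the inherited inner product), $U$ being the inclusion (extension by zero). *)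

(* Defs.v *)
From HB Require Import structures.
From mathcomp Require Import all_boot all_order all_algebra finmap complex.
From mathcomp Require Import all_classical all_reals all_analysis.
Set Implicit Arguments.
Unset Strict Implicit.
Unset Printing Implicit Defensive.
Import Order.TTheory GRing.Theory Num.Theory numFieldNormedType.Exports.
Local Open Scope classical_set_scope.
Local Open Scope ring_scope.

(* {ffun T -> R[i]^o} rather than {ffun T -> R[i]}: the regular module R[i]^o
   makes function spaces complex, not real, vector spaces. *)
Notation plane R := (R * R)%type.
Notation cfun V C := {ffun V -> C^o}.

Section Diamond.
Variables (R : realType) (s : R).

Definition diamond_map (j : nat) (x : plane R) : plane R :=
  (2^-1 * x.1 + (Num.sqrt 2)^-1 * cos ((2 * j%:R - 1) * pi / 4),
   2^-1 * ((-1) ^+ j * x.1 + 4 * s * x.2)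
     + (Num.sqrt 2)^-1 * sin ((2 * j%:R - 1) * pi / 4)).

(* The letter i : 'I_4 stands for the index j = i + 1 of {1, 2, 3, 4}. *)
Definition letter_map (i : 'I_4) : plane R -> plane R := diamond_map i.+1.

Definition word_map (w : seq 'I_4) : plane R -> plane R :=
  foldr (fun i F => letter_map i \o F) id w.

Definition is_attractor (X : set (plane R)) : Prop :=
  [/\ compact X, X !=set0 & X = \bigcup_(i : 'I_4) (letter_map i @` X)].

Definition V0 : {fset plane R} := [fset ((- 1, 0) : plane R); (1, 0)]%fset.

Fixpoint V (m : nat) : {fset plane R} :=
  if m is n.+1
  then [fset letter_map i x | i in 'I_4, x in V n]%fset
  else V0.

Definition is_edge (w : seq 'I_4) (x y : plane R) : bool :=
  [fset x; y]%fset == [fset word_map w v | v in V0]%fset.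

Definition adj (m : nat) (x y : plane R) : bool :=
  [exists w : m.-tuple 'I_4, is_edge w x y].

Definition deg (m : nat) (x : plane R) : nat :=
  #|[set y : V m | adj m x (val y)]%SET|.

Definition ofreal (f : plane R -> R) : plane R -> R[i] :=
  fun x => ((f x)%:C)%C.

(* A function on X is represented by a function on the plane; only its values
   on X are ever used (on the union of the V m for the energies). *)
Definition energy (m : nat) (f : plane R -> R[i]) : R :=
  2^-1 * \sum_(x : V m) \sum_(y : V m | adj m (val x) (val y))
           complex.Re (`|f (val x) - f (val y)|) ^+ 2.

Definition energy_form (m : nat) (f g : plane R -> R[i]) : R[i] :=
  2^-1 * \sum_(x : V m) \sum_(y : V m | adj m (val x) (val y))
           (f (val x) - f (val y)) * (g (val x) - g (val y))^*.

(* Square integrability is not asked for: energies only see the values of f on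
   the countable union of the V m, which can be matched by a square integrable
   function, so that condition would not change the space of 1-forms. *)
Definition in_domain (f : plane R -> R[i]) : Prop :=
  cvgn (fun m => energy m f).

Definition dirichlet (f : plane R -> R[i]) : R := limn (fun m => energy m f).

Definition harmonic_at (m : nat) (h : plane R -> R[i]) : Prop :=
  in_domain h /\ forall n, (m <= n)%N -> energy n h = energy m h.

Section OneForms.
Variable X : set (plane R).

Definition cell (w : seq 'I_4) : set (plane R) := word_map w @` X.

Definition cell_indic (w : seq 'I_4) : plane R -> R[i] := ofreal (\1_(cell w)).

(* nu = Gamma(f, f).  For bounded f the limit below is
   Re E(f phi, f) - E(|f|^2, phi) / 2, the usual definition of
   the integral of phi against Gamma(f, f); taking the limit of the combination
   also covers unbounded f, for which f phi and |f|^2 may have infinite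
   energy. *)
Definition is_energy_measure (f : plane R -> R[i])
    (nu : {finite_measure set (plane R) -> \bar R}) : Prop :=
  [/\ nu (~` X) = 0%E,
      nu X = (dirichlet f)%:E
    & forall phi : plane R -> R,
        {within X, continuous phi} -> in_domain (ofreal phi) ->
        (fun m => complex.Re
           (energy_form m (fun x => f x * ofreal phi x) f
            - 2^-1 * energy_form m (fun x => f x * (f x)^*) (ofreal phi)))
          @ \oo --> \int[nu]_(x in X) phi x].

Definition cintegral (nu : {finite_measure set (plane R) -> \bar R})
    (h : plane R -> R[i]) : R[i] :=
  (\int[nu]_(x in X) complex.Re (h x) +i* \int[nu]_(x in X) complex.Im (h x))%C.

(* The integral of h against Gamma(f, f'), by polarization:
   Gamma(f, f') = 1/4 sum_(k < 4) i^k Gamma(f + i^k f', f + i^k f'). *)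
Definition mutual_integral
    (Gam : (plane R -> R[i]) -> {finite_measure set (plane R) -> \bar R})
    (h f f' : plane R -> R[i]) : R[i] :=
  4^-1 * \sum_(k < 4)
    ('i%C ^+ k * cintegral (Gam (fun x => f x + 'i%C ^+ k * f' x)) h).

Definition bounded_borel (g : plane R -> R[i]) : Prop :=
  [/\ measurable_fun X (fun x => complex.Re (g x)),
      measurable_fun X (fun x => complex.Im (g x))
    & exists K : R, forall x, X x -> complex.Re `|g x| <= K].

End OneForms.
End Diamond.

Section HilbertSpaces.
Variable R : realType.
Implicit Types H U : lmodType R[i].

Definition hnorm H (ip : H -> H -> R[i]) (u : H) : R :=
  Num.sqrt (complex.Re (ip u u)).

Definition is_hilbert H (ip : H -> H -> R[i]) : Prop :=
  [/\ forall (c : R[i]) u v w, ip (c *: u + v) w = c * ip u w + ip v w,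
      forall u v, ip v u = (ip u v)^*,
      forall u, 0 <= ip u u,
      forall u, ip u u = 0 -> u = 0
    & forall u : nat -> H,
        (forall e : R, 0 < e -> exists N : nat, forall i j,
           (N <= i)%N -> (N <= j)%N -> hnorm ip (u i - u j) < e) ->
        exists l : H, (fun n => hnorm ip (u n - l)) @ \oo --> (0 : R)].

Definition span_over (K : set R[i]) H (S : set H) : set H :=
  [set v | exists n (c : 'I_n -> R[i]) (u : 'I_n -> H),
     (forall i, K (c i)) /\ (forall i, S (u i)) /\ v = \sum_i c i *: u i].

Definition hclosure H (ip : H -> H -> R[i]) (S : set H) : set H :=
  [set v | forall e : R, 0 < e -> exists2 u, S u & hnorm ip (v - u) < e].

Definition is_orth_proj H (ip : H -> H -> R[i]) (S : set H) (a b : H) : Prop :=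
  S b /\ forall v, S v -> ip (a - b) v = 0.

Definition bounded_op U (ip : U -> U -> R[i]) (M : U -> U) : Prop :=
  linear M /\ exists K : R, forall u, hnorm ip (M u) <= K * hnorm ip u.

Definition is_inverse U (M N : U -> U) : Prop := cancel M N /\ cancel N M.

(* dom is the common domain of definition of phi0 and phi1; it has to be
   recorded because division by zero is total here. *)
Definition spectrally_similar U U0 (ip : U -> U -> R[i])
    (ip0 : U0 -> U0 -> R[i]) (J : U0 -> U) (M : U -> U) (M0 : U0 -> U0)
    (dom : set R[i]) (phi0 phi1 : R[i] -> R[i]) : Prop :=
  [/\ bounded_op ip M /\ bounded_op ip0 M0,
      exists u, M0 u <> u,
      linear J /\ (forall u v, ip (J u) (J v) = ip0 u v)
    & exists Lam : set R[i],
        [/\ open (Lam : set R[i]^o), Lam !=set0, Lam `<=` dom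
          & forall z, Lam z ->
            exists (Rz : U -> U) (Jstar : U -> U0) (Sz : U0 -> U0),
              [/\ is_inverse (fun u => M u - z *: u) Rz,
                  forall u v, ip (J u) v = ip0 u (Jstar v),
                  is_inverse (fun u => phi0 z *: M0 u - phi1 z *: u) Sz
                & forall u, Jstar (Rz (J u)) = Sz u]]].

End HilbertSpaces.

Section Forms.
Variables (R : realType) (s : R) (X : set (plane R)).
Variables (H : lmodType R[i]) (ip : H -> H -> R[i]).
(* tensor f g is the class of f (x) g; only f in the domain and g bounded
   Borel are meaningful, and h (f (x) g) = f (x) (h g). *)
Variable tensor : (plane R -> R[i]) -> (plane R -> R[i]) -> H.

Definition simple_tensors : set H :=
  [set v | exists f g,
     [/\ in_domain s f, bounded_borel X g & v = tensor f g]].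

Definition real_tensors : set H :=
  [set v | exists f g : plane R -> R,
     [/\ in_domain s (ofreal f), bounded_borel X (ofreal g)
       & v = tensor (ofreal f) (ofreal g)]].

(* (H, ip, tensor) is the Hilbert space completion of the span of the f (x) g
   modulo null vectors, characterized (up to a unique unitary map carrying
   tensor to tensor) by the prescribed inner products and density. *)
Definition is_oneform_space : Prop :=
  [/\ is_hilbert ip,
      exists Gam : (plane R -> R[i]) ->
                   {finite_measure set (plane R) -> \bar R},
        (forall f, in_domain s f -> is_energy_measure s X f (Gam f)) /\
        (forall f f' g g', in_domain s f -> in_domain s f' ->
           bounded_borel X g -> bounded_borel X g' ->
           ip (tensor f g) (tensor f' g')
             = mutual_integral X Gam (fun x => g x * (g' x)^*) f f')
    & forall v, hclosure ip (span_over setT simple_tensors) v].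

Definition real_valued : set H :=
  hclosure ip (span_over [set z | z \is Num.real] real_tensors).

(* (d A) 1_w = A (x) 1_w *)
Definition Hscale (m : nat) : set H :=
  span_over setT
    [set v | exists (w : m.-tuple 'I_4) (A : plane R -> R[i]),
       harmonic_at s m A /\ v = tensor A (cell_indic s X w)].

(* theta x y is b(e_xy); theta is unconstrained off the scale-m edges. *)
Definition is_edge_function (m : nat) (b : H)
    (theta : plane R -> plane R -> R) : Prop :=
  exists A : m.-tuple 'I_4 -> plane R -> R,
    [/\ forall w, harmonic_at s m (ofreal (A w)),
        b = \sum_(w : m.-tuple 'I_4)
              tensor (ofreal (A w)) (cell_indic s X w)
      & forall (w : m.-tuple 'I_4) x y, is_edge s w x y ->
          theta x y = A w y - A w x].

Definition loop_edges (w : seq 'I_4) : seq (plane R * plane R) :=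
  let P1 := word_map s w (- 1, 0) in let P2 := word_map s w (0, - 1) in
  let P3 := word_map s w (1, 0) in let P4 := word_map s w (0, 1) in
  [:: (P1, P2); (P2, P3); (P3, P4); (P4, P1)].

Definition loop_function (w : seq 'I_4) (x y : plane R) : R :=
  ((x, y) \in loop_edges w)%:R - ((y, x) \in loop_edges w)%:R.

(* a_ m is meant to be the projection of a 1-form on Hscale m, for m = 0 too:
   since each k w is orthogonal to Hscale 0, an element a_0 of Hscale 0 with
   a_1 = a_0 + beta_1 k is necessarily that projection. *)
Definition flux_scale_only (a_ : nat -> H) (beta : nat -> R) : Prop :=
  forall m, exists k : m.-tuple 'I_4 -> H,
    (forall w, is_edge_function m.+1 (k w) (loop_function w)) /\
    a_ m.+1 = a_ m + ((beta m.+1)%:C)%C *: \sum_(w : m.-tuple 'I_4) k w.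

End Forms.

Section MagneticOperator.
Variables (R : realType) (s : R).

Definition expi (t : R) : R[i] := (cos t +i* sin t)%C.

Definition magnetic (m : nat) (theta : plane R -> plane R -> R)
    (f : cfun (V s m) R[i]) : cfun (V s m) R[i] :=
  [ffun x : V s m => - ((deg s m (val x))%:R)^-1 *
     \sum_(y : V s m | adj s m (val x) (val y))
        (f x - f y * expi (theta (val x) (val y)))].

Definition neg_magnetic (m : nat) (theta : plane R -> plane R -> R)
    (f : cfun (V s m) R[i]) : cfun (V s m) R[i] := - magnetic theta f.

Definition graph_ip (m : nat) (f g : cfun (V s m) R[i]) : R[i] :=
  \sum_(x : V s m) (deg s m (val x))%:R * (f x * (g x)^*).

Definition extend0 (n m : nat) (f : cfun (V s n) R[i]) : cfun (V s m) R[i] :=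
  [ffun x : V s m => (if insub (val x) is Some y then f y else 0) : R[i]^o].

(* Functions on V n carry the inner product inherited from V m: the weights
   are deg_m, not deg_n. *)
Definition inherited_ip (n m : nat) (f g : cfun (V s n) R[i]) : R[i] :=
  graph_ip (extend0 m f) (extend0 m g).

Definition phi0 (b : R) (z : R[i]) : R[i] :=
  ((cos (2 * b))%:C)%C / (2 * (1 - z)).

Definition phi1 (b : R) (z : R[i]) : R[i] :=
  (- 2 * z ^+ 2 + 4 * z - 1 + ((cos (2 * b))%:C)%C) / (2 * (1 - z)).

End MagneticOperator.

(* Main.v *)
(* Scale-m vertices split into those of V_(m-1) and the midpoints F_w(0, 1), F_w(0, -1) with
   |w| = m - 1; each set has neighbours only in the other.  Hence the compression of
   (-M - z)^-1 to V_(m-1) is the inverse of the Schur complement of the midpoints.  An edge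
   F_w(V_0) of scale m - 1 carrying phase t is joined by two paths of length two, whose phases
   are t + 2 beta_m and t - 2 beta_m, and exp(i(t + 2 beta)) + exp(i(t - 2 beta)) =
   2 cos(2 beta) exp(i t): the Schur complement is phi_0 (-M_(m-1)) - phi_1.

   The phases of the half-edges, t / 2 + beta_m and t / 2 - beta_m, have to be extracted from an
   identity between elements of the Hilbert space of 1-forms.  Pair it with the 1-form
   x_1 (x) phi, where phi is a Lipschitz bump supported in the interior of the m-cell of a word v:
   as harmonic functions halve their increments at each subdivision, the pairing with A (x) 1_u is
   0 unless u is a prefix of v, and otherwise is the increment of A along F_v(V_0) times a positive
   factor depending only on v. *)
Require Import Defs.
From HB Require Import structures.
From mathcomp Require Import all_boot all_order all_algebra finmap complex.
From mathcomp Require Import all_classical all_reals all_analysis.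
From mathcomp Require Import measurable_realfun ring lra.
Set Implicit Arguments.
Unset Strict Implicit.
Unset Printing Implicit Defensive.
Import Order.TTheory GRing.Theory Num.Theory numFieldNormedType.Exports.
Local Open Scope classical_set_scope.
Local Open Scope ring_scope.

(** * Cells and vertices *)

Section Maps.
Variables (R : realType) (s : R).
Implicit Types (p q : plane R) (w v : seq 'I_4).

Lemma sincos_piquarter :
  (Num.sqrt 2)^-1 * cos (pi / 4) = 2^-1 :> R /\
  (Num.sqrt 2)^-1 * sin (pi / 4) = 2^-1 :> R.
Proof.
have c0 : 0 < cos (pi / 4 : R).
  by apply: cos_gt0_pihalf; have := pi_gt0 R; set t : R := pi; lra.
have sc : sin (pi / 4) = cos (pi / 4) :> R.
  by have /divr1_eq := tan_piquarter R.
rewrite sc; suff e : (Num.sqrt 2)^-1 * cos (pi / 4) = 2^-1 :> R by [].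
have q0 : 0 < (Num.sqrt 2)^-1 :> R by rewrite invr_gt0 sqrtr_gt0.
have c2 : cos (pi / 4) ^+ 2 = 2^-1 :> R.
  by have := cos2Dsin2 (pi / 4 : R); rewrite sc; lra.
have q2 : (Num.sqrt 2)^-1 ^+ 2 = 2^-1 :> R by rewrite exprVn sqr_sqrtr.
apply: (@pexpIrn _ 2) => //; rewrite ?nnegrE ?invr_ge0// ?mulr_ge0 ?ltW//.
by rewrite exprMn c2 q2; lra.
Qed.

Lemma diamond_map1 p :
  diamond_map s 1 p = ((p.1 + 1) / 2, (1 - p.1) / 2 + 2 * s * p.2).
Proof.
have [c1 s1] := sincos_piquarter.
rewrite /diamond_map (_ : (2 * 1%:R - 1) * pi / 4 = pi / 4); last by lra.
by rewrite c1 s1 expr1; congr pair; field.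
Qed.

Lemma diamond_map2 p :
  diamond_map s 2 p = ((p.1 - 1) / 2, (1 + p.1) / 2 + 2 * s * p.2).
Proof.
have [c1 s1] := sincos_piquarter.
rewrite /diamond_map (_ : (2 * 2%:R - 1) * pi / 4 = pi / 4 + pi / 2); last by lra.
by rewrite cosDpihalf sinDpihalf mulrN c1 s1 sqrrN expr1n; congr pair; field.
Qed.

Lemma diamond_map3 p :
  diamond_map s 3 p = ((p.1 - 1) / 2, - (1 + p.1) / 2 + 2 * s * p.2).
Proof.
have [c1 s1] := sincos_piquarter.
rewrite /diamond_map (_ : (2 * 3%:R - 1) * pi / 4 = pi / 4 + pi); last by lra.
by rewrite cosDpi sinDpi !mulrN c1 s1 -signr_odd /= expr1; congr pair; field.
Qed.

Lemma diamond_map4 p :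
  diamond_map s 4 p = ((p.1 + 1) / 2, (p.1 - 1) / 2 + 2 * s * p.2).
Proof.
have [c1 s1] := sincos_piquarter.
rewrite /diamond_map.
rewrite (_ : (2 * 4%:R - 1) * pi / 4 = pi / 4 + pi / 2 + pi); last by lra.
rewrite cosDpi sinDpi cosDpihalf sinDpihalf opprK mulrN c1 s1 -signr_odd /=.
by rewrite expr0; congr pair; field.
Qed.

Definition letter1 : 'I_4 := Ordinal (isT : (0 < 4)%N).
Definition letter2 : 'I_4 := Ordinal (isT : (1 < 4)%N).
Definition letter3 : 'I_4 := Ordinal (isT : (2 < 4)%N).
Definition letter4 : 'I_4 := Ordinal (isT : (3 < 4)%N).

Lemma lettersP (P : 'I_4 -> Prop) : P letter1 -> P letter2 -> P letter3 ->
  P letter4 -> forall i, P i.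
Proof.
move=> P1 P2 P3 P4 [[|[|[|[|//]]]] i4].
- by rewrite (_ : Ordinal _ = letter1)//; apply: val_inj.
- by rewrite (_ : Ordinal _ = letter2)//; apply: val_inj.
- by rewrite (_ : Ordinal _ = letter3)//; apply: val_inj.
- by rewrite (_ : Ordinal _ = letter4)//; apply: val_inj.
Qed.

Definition letter_mapE :=
  (diamond_map1 : forall p, letter_map s letter1 p = _,
   diamond_map2 : forall p, letter_map s letter2 p = _,
   diamond_map3 : forall p, letter_map s letter3 p = _,
   diamond_map4 : forall p, letter_map s letter4 p = _).

Lemma sum_letters (M : nmodType) (F : 'I_4 -> M) :
  \sum_i F i = F letter1 + F letter2 + F letter3 + F letter4.
Proof.
rewrite !big_ord_recr big_ord0 /= add0r.
by congr (_ + _ + _ + _); congr F; apply: val_inj.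
Qed.

Lemma word_map_cat w v p : word_map s (w ++ v) p = word_map s w (word_map s v p).
Proof. by elim: w => //= i w IH; rewrite /= IH. Qed.

Lemma word_map_cons i w p : word_map s (i :: w) p = letter_map s i (word_map s w p).
Proof. by []. Qed.

Lemma word_map_rcons w i p : word_map s (rcons w i) p = word_map s w (letter_map s i p).
Proof. by rewrite -cats1 word_map_cat. Qed.

Definition vleft : plane R := (- 1, 0).
Definition vright : plane R := (1, 0).
Definition vtop : plane R := (0, 1).
Definition vbot : plane R := (0, - 1).

Lemma letter_map_V0 :
  (letter_map s letter1 vleft = vtop) * (letter_map s letter1 vright = vright) *
  (letter_map s letter2 vleft = vleft) * (letter_map s letter2 vright = vtop) *
  (letter_map s letter3 vleft = vleft) * (letter_map s letter3 vright = vbot) *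
  (letter_map s letter4 vleft = vbot) * (letter_map s letter4 vright = vright).
Proof. by rewrite !letter_mapE /=; do !split; congr pair; lra. Qed.

Lemma mem_V0 p : (p \in V0 R) = (p == vleft) || (p == vright).
Proof. by rewrite /V0 !inE. Qed.

(* Its closed unit ball is a rhombus with vertices (-1, 0), (0, 2), (1, 0), (0, -2) which the
   four maps send into itself, with disjoint interiors. *)
Definition gauge p := `|p.1| + `|p.2| / 2.

Hypotheses (s_gt0 : 0 < s) (s_le : s <= 8^-1).

Lemma letter_map_inj i : injective (letter_map s i).
Proof.
move: i; apply: lettersP => -[x1 x2] [y1 y2]; rewrite !letter_mapE /= => -[e1 e2].
all: have {}e1 : x1 = y1 by lra.
all: have : s * (x2 - y2) = 0 by move: e2; rewrite e1; nra.
all: move/eqP; rewrite mulf_eq0 gt_eqF //= subr_eq0 => /eqP e; by rewrite e1 e.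
Qed.

Lemma word_map_inj w : injective (word_map s w).
Proof. by elim: w => [|i w IH] x y //= /letter_map_inj /IH. Qed.

Lemma vertical_shrink (x : R) : `|2 * s * x| <= `|x| / 4.
Proof.
rewrite !normrM (gtr0_norm s_gt0) normr_nat.
have : 0 <= (8^-1 - s) * `|x| by rewrite mulr_ge0 ?subr_ge0.
by lra.
Qed.

Let gauge_shrink (x t : R) : 0 <= t ->
  `|x - 1| / 2 + `|1 + x| / 4 + t / 8 <=
  Num.max ((3 + (`|x| + t / 2)) / 4) ((3 * (`|x| + t / 2) + 1) / 4).
Proof.
move=> t0; rewrite le_max; apply/orP.
case: (ger0P x) => x0; case: (ger0P (x - 1)) => x1; case: (ger0P (1 + x)) => x2.
all: by (left; lra) || (right; lra).
Qed.

Let gauge_shrinkN (x t : R) : 0 <= t ->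
  `|x + 1| / 2 + `|1 - x| / 4 + t / 8 <=
  Num.max ((3 + (`|x| + t / 2)) / 4) ((3 * (`|x| + t / 2) + 1) / 4).
Proof.
move=> /(gauge_shrink (- x)); rewrite normrN; apply: le_trans.
by rewrite -(normrN (x + 1)) opprD.
Qed.

Lemma gauge_letter_map i p :
  gauge (letter_map s i p) <= Num.max ((3 + gauge p) / 4) ((3 * gauge p + 1) / 4).
Proof.
case: p => x y; have := vertical_shrink y; move: i.
apply: lettersP; rewrite !letter_mapE /gauge /=; move: (2 * s * y) => z zy.
- have := gauge_shrinkN x (normr_ge0 y); apply: le_trans.
  have := ler_normD ((1 - x) / 2) z.
  by rewrite !normrM !normfV !normr_nat; lra.
- have := gauge_shrink x (normr_ge0 y); apply: le_trans.
  have := ler_normD ((1 + x) / 2) z.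
  by rewrite !normrM !normfV !normr_nat; lra.
- have := gauge_shrink x (normr_ge0 y); apply: le_trans.
  have := ler_normD (- (1 + x) / 2) z.
  by rewrite !normrM !normfV !normr_nat normrN; lra.
- have := gauge_shrinkN x (normr_ge0 y); apply: le_trans.
  have := ler_normD ((x - 1) / 2) z.
  by rewrite !normrM !normfV !normr_nat -(normrN (1 - x)) opprB; lra.
Qed.

End Maps.

Section Graph.
Variables (R : realType) (s : R).
Hypotheses (s_gt0 : 0 < s) (s_le : s <= 8^-1).
Implicit Types (p q x y : plane R) (w v : seq 'I_4).

Lemma letter_map_separated i j p q : gauge p < 1 -> gauge q <= 1 ->
  letter_map s i p = letter_map s j q -> i = j.
Proof.
case: p q => [x y] [x' y']; rewrite /gauge /=.
have := vertical_shrink s_gt0 s_le y; have := vertical_shrink s_gt0 s_le y'.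
rewrite !(ler_norml (_ * _)) => /andP + /andP.
have := ler_norm x; have := ler_norm x'.
have := ler_norm (- x); have := ler_norm (- x'); rewrite !normrN.
move: i j; apply: lettersP; apply: lettersP; rewrite ?letter_mapE //=.
all: move: (2 * s * y) (2 * s * y') `|x| `|x'| `|y| `|y'| => ? ? ? ? ? ?.
all: by move=> ? ? ? ? [? ?] [? ?] ? ? [? ?]; exfalso; lra.
Qed.

Lemma gauge_letter_map_le1 i p : gauge p <= 1 -> gauge (letter_map s i p) <= 1.
Proof.
by move=> g1; apply: le_trans (gauge_letter_map s_gt0 s_le i p) _; rewrite ge_max; lra.
Qed.

Lemma gauge_letter_map_lt1 i p : gauge p < 1 -> gauge (letter_map s i p) < 1.
Proof.
move=> g1; apply: le_lt_trans (gauge_letter_map s_gt0 s_le i p) _.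
by rewrite gt_max; lra.
Qed.

Lemma gauge_word_map_le1 w p : gauge p <= 1 -> gauge (word_map s w p) <= 1.
Proof. by move=> g1; elim: w => //= i w IH; apply: gauge_letter_map_le1. Qed.

Lemma gauge_word_map_lt1 w p : gauge p < 1 -> gauge (word_map s w p) < 1.
Proof. by move=> g1; elim: w => //= i w IH; apply: gauge_letter_map_lt1. Qed.

Lemma word_map_separated w v p q : size w = size v -> gauge p < 1 -> gauge q <= 1 ->
  word_map s w p = word_map s v q -> w = v.
Proof.
move=> + gp gq; elim: w v => [|i w IH] [|j v] //= [szwv] e.
have ij : i = j by apply: letter_map_separated e;
  [exact: gauge_word_map_lt1|exact: gauge_word_map_le1].
by rewrite -ij in e *; rewrite (IH v)//; exact: (letter_map_inj s_gt0 e).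
Qed.

Lemma gauge_V0 : (gauge (vleft R) = 1) * (gauge (vright R) = 1).
Proof. by rewrite /gauge /= normrN normr1 normr0; split; lra. Qed.

Lemma gauge_mid : (gauge (vtop R) = 2^-1) * (gauge (vbot R) = 2^-1).
Proof. by rewrite /gauge /= normrN normr1 normr0; split; lra. Qed.

Definition xl w := word_map s w (vleft R).
Definition xr w := word_map s w (vright R).
Definition mid (b : bool) w := word_map s w (if b then vtop R else vbot R).

Let gauge_end (b : bool) : gauge (if b then vleft R else vright R) <= 1.
Proof. by case: b; rewrite gauge_V0. Qed.

Let gauge_midb (b : bool) : gauge (if b then vtop R else vbot R) < 1.
Proof. by case: b; rewrite gauge_mid; lra. Qed.

Lemma mid_neq_xl b w v : size w = size v -> mid b w != xl v.
Proof.
move=> sz; apply/eqP => e; have := e.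
rewrite (word_map_separated sz (gauge_midb b) (gauge_end true) e).
by move=> /(word_map_inj s_gt0); case: b {e} => -[]; lra.
Qed.

Lemma mid_neq_xr b w v : size w = size v -> mid b w != xr v.
Proof.
move=> sz; apply/eqP => e; have := e.
rewrite (word_map_separated sz (gauge_midb b) (gauge_end false) e).
by move=> /(word_map_inj s_gt0); case: b {e} => -[]; lra.
Qed.

Lemma mid_inj b c w v : size w = size v -> mid b w = mid c v -> b = c /\ w = v.
Proof.
move=> sz e; have wv := word_map_separated sz (gauge_midb b) (ltW (gauge_midb c)) e.
split=> //; move: e; rewrite wv => /(word_map_inj s_gt0).
by case: b; case: c => // -[]; lra.
Qed.

Lemma xl_neq_xr w : xl w != xr w.
Proof. by apply/eqP => /(word_map_inj s_gt0) -[]; lra. Qed.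

Let word_map_mid w : 2 *: word_map s w 0 = xl w + xr w.
Proof.
rewrite /xl /xr (_ : (0 : plane R) = 2^-1 *: (vleft R + vright R)); last first.
  by apply: injective_projections; rewrite /= /GRing.scale /=; lra.
move: (vleft R) (vright R); elim: w => [|i w IH] x y /=.
  by rewrite scalerA mulfV// scale1r.
rewrite (_ : word_map s w _ = 2^-1 *: (word_map s w x + word_map s w y)); last first.
  by rewrite -IH scalerA mulVf// scale1r.
move: (word_map s w x) (word_map s w y) => [a b] [c d].
by move: i; apply: lettersP; rewrite !letter_mapE; apply: injective_projections;
  rewrite /= {1}/GRing.scale /= /GRing.scale /=; lra.
Qed.

(* A word is recovered from its edge through the image of the origin, the midpoint of
   the edge, which lies in the interior of the rhombus. *)
Lemma edge_inj w v : size w = size v -> xl w + xr w = xl v + xr v -> w = v.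
Proof.
rewrite -!word_map_mid => sz /(scalerI (ltac:(by []) : 2 != 0 :> R)).
by apply: word_map_separated => //; rewrite /gauge /= normr0; lra.
Qed.

Lemma mem_V m x :
  reflect (exists w : m.-tuple 'I_4, x = xl w \/ x = xr w) (x \in V s m).
Proof.
apply: (iffP idP).
  elim: m x => [|m IH] x /=.
    by rewrite mem_V0 => /orP[] /eqP ->; exists [tuple]; [left|right].
  case/imfset2P => i _ [y /IH [w yw] ->].
  by exists [tuple of i :: w]; case: yw => ->; [left|right].
elim: m x => [|m IH] x /= [w xw].
  have w0 : tval w = [::] by rewrite (tuple0 w).
  by rewrite mem_V0; case: xw => ->; rewrite w0 eqxx ?orbT.
have wE : tval w = thead w :: behead w by rewrite [in LHS](tuple_eta w).
case: xw => ->; rewrite wE; apply/imfset2P; exists (thead w) => //.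
  by exists (xl (behead w)) => //; apply: IH; exists [tuple of behead w]; left.
by exists (xr (behead w)) => //; apply: IH; exists [tuple of behead w]; right.
Qed.

Lemma xl_V m (w : m.-tuple 'I_4) : xl w \in V s m.
Proof. by apply/mem_V; exists w; left. Qed.

Lemma xr_V m (w : m.-tuple 'I_4) : xr w \in V s m.
Proof. by apply/mem_V; exists w; right. Qed.

Lemma mid_notin_V m b (w : m.-tuple 'I_4) : mid b w \notin V s m.
Proof.
apply/negP => /mem_V [v [] /eqP]; apply/negP; [apply: mid_neq_xl|apply: mid_neq_xr];
  by rewrite !size_tuple.
Qed.

Lemma is_edgeE w x y :
  is_edge s w x y = (x == xl w) && (y == xr w) || (x == xr w) && (y == xl w).
Proof.
rewrite /is_edge (_ : [fset _ _ | _ in V0 R]%fset = [fset xl w; xr w]%fset); last first.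
  apply/fsetP => z; rewrite !inE; apply/imfsetP/orP.
    by move=> [u]; rewrite /= mem_V0 => /orP[] /eqP -> ->; [left|right].
  by move=> [] /eqP ->; [exists (vleft R)|exists (vright R)] => //=;
    rewrite mem_V0 eqxx ?orbT.
apply/eqP/orP => [/fsetP e|].
  have lr := xl_neq_xr w.
  have := e (xl w); have := e (xr w); rewrite !inE !eqxx !orbT /=.
  move=> /orP[] /eqP er /orP[] /eqP el; first 1 last.
  - by right; rewrite er el !eqxx.
  - by left; rewrite er el !eqxx.
  - by move: lr; rewrite er el eqxx.
  - by move: lr; rewrite er el eqxx.
by move=> [] /andP[/eqP -> /eqP ->] //; rewrite fsetUC.
Qed.

Lemma is_edge_sym w x y : is_edge s w x y = is_edge s w y x.
Proof. by rewrite !is_edgeE orbC !(andbC (y == _)). Qed.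

Lemma is_edge_inj m (w v : m.-tuple 'I_4) x y :
  is_edge s w x y -> is_edge s v x y -> w = v.
Proof.
rewrite !is_edgeE => e1 e2; apply: val_inj; apply: edge_inj; first by rewrite !size_tuple.
have -> : xl w + xr w = x + y.
  by case/orP: e1 => /andP[/eqP -> /eqP ->] //; rewrite addrC.
by case/orP: e2 => /andP[/eqP -> /eqP ->] //; rewrite addrC.
Qed.

Lemma sum_neighbours (M : nmodType) m x (g : plane R -> M) :
  \sum_(y : V s m | adj s m x (val y)) g (val y) =
  \sum_(w : m.-tuple 'I_4)
    ((if x == xl w then g (xr w) else 0) + (if x == xr w then g (xl w) else 0)).
Proof.
transitivity (\sum_(y : V s m) \sum_(w : m.-tuple 'I_4 | is_edge s w x (val y)) g (val y)).
  rewrite big_mkcond; apply: eq_bigr => y _; case: ifPn => [/existsP[w ew]|].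
    rewrite (big_pred1 w) // => v; apply/idP/eqP => [ev|-> //].
    exact: is_edge_inj ev ew.
  by rewrite negb_exists => /forallP ne; rewrite big_pred0 // => w; apply/negbTE.
rewrite (exchange_big_dep predT) //=; apply: eq_bigr => w _.
have big1P z (zV : z \in V s m) (P : pred (V s m)) : (forall y : V s m, P y = (val y == z)) ->
    \sum_(y | P y) g (val y) = g z.
  by move=> PE; rewrite (big_pred1 [` zV]%fset).
case: eqVneq => [xE|xl'].
  rewrite xE (negbTE (xl_neq_xr w)) addr0; apply: big1P (xr_V w) _ _ => y.
  by rewrite is_edgeE eqxx (negbTE (xl_neq_xr w)) /= orbF.
case: eqVneq => [xE|xr'].
  rewrite add0r; apply: big1P (xl_V w) _ _ => y.
  by rewrite is_edgeE (negbTE xl') xE eqxx.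
by rewrite addr0 big_pred0 // => y; rewrite is_edgeE (negbTE xl') (negbTE xr').
Qed.

Lemma sum_adjacent (M : nmodType) m (g : plane R -> plane R -> M) :
  \sum_(x : V s m) \sum_(y : V s m | adj s m (val x) (val y)) g (val x) (val y) =
  \sum_(w : m.-tuple 'I_4) (g (xl w) (xr w) + g (xr w) (xl w)).
Proof.
under eq_bigr do rewrite (sum_neighbours _ _ (g _)).
rewrite exchange_big /=; apply: eq_bigr => w _; rewrite big_split /=; congr (_ + _).
  by rewrite -big_mkcond /= (big_pred1 [` xl_V w]%fset).
by rewrite -big_mkcond /= (big_pred1 [` xr_V w]%fset).
Qed.

Lemma degE m x :
  deg s m x = (\sum_(w : m.-tuple 'I_4) ((x == xl w) + (x == xr w)))%N.
Proof.
rewrite /deg -sum1_card; under eq_bigl do rewrite inE.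
rewrite (sum_neighbours m x (fun=> 1%N)); apply: eq_bigr => w _.
by case: (x == _); case: (x == _).
Qed.

Lemma deg_gt0 m x : x \in V s m -> (0 < deg s m x)%N.
Proof.
move=> /mem_V[w xw]; rewrite degE (bigD1 w) //=.
by case: xw => ->; rewrite eqxx ?addn1.
Qed.

Lemma sum_tuple_rcons (M : nmodType) m (F : seq 'I_4 -> M) :
  \sum_(w : m.+1.-tuple 'I_4) F w =
  \sum_(w : m.-tuple 'I_4) \sum_(i : 'I_4) F (rcons w i).
Proof.
rewrite pair_big /=.
rewrite (reindex (fun wi : m.-tuple 'I_4 * 'I_4 => [tuple of rcons wi.1 wi.2])) //=.
exists (fun v : m.+1.-tuple 'I_4 =>
  ([tuple of belast (thead v) (behead v)], last (thead v) (behead v))).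
  move=> [w i] _; congr pair; first apply: val_inj => /=.
    by rewrite /thead (tnth_nth i) /=; case: (val w) => //= j u; rewrite belast_rcons.
  by rewrite /thead (tnth_nth i) /=; case: (val w) => //= j u; rewrite last_rcons.
by move=> v _; apply: val_inj => /=; rewrite -lastI [in RHS](tuple_eta v).
Qed.

Lemma sum_tuple_cons (M : nmodType) m (F : seq 'I_4 -> M) :
  \sum_(w : m.+1.-tuple 'I_4) F w =
  \sum_(i : 'I_4) \sum_(w : m.-tuple 'I_4) F (i :: w).
Proof.
rewrite pair_big /=.
rewrite (reindex (fun wi : 'I_4 * m.-tuple 'I_4 => [tuple of wi.1 :: wi.2])) //=.
exists (fun v : m.+1.-tuple 'I_4 => (thead v, [tuple of behead v])).
  by move=> [i w] _; congr pair; apply: val_inj.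
by move=> v _; rewrite [RHS]tuple_eta.
Qed.

Lemma xl_rcons w : (xl (rcons w letter1) = mid true w) * (xl (rcons w letter2) = xl w) *
  (xl (rcons w letter3) = xl w) * (xl (rcons w letter4) = mid false w).
Proof. by rewrite /xl !word_map_rcons !letter_map_V0. Qed.

Lemma xr_rcons w : (xr (rcons w letter1) = xr w) * (xr (rcons w letter2) = mid true w) *
  (xr (rcons w letter3) = mid false w) * (xr (rcons w letter4) = xr w).
Proof. by rewrite /xr !word_map_rcons !letter_map_V0. Qed.

Lemma V_subS m x : x \in V s m -> x \in V s m.+1.
Proof.
move=> /mem_V[w [] ->].
  by rewrite -(xl_rcons w); apply: (xl_V [tuple of rcons w letter2]).
by rewrite -(xr_rcons w); apply: (xr_V [tuple of rcons w letter1]).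
Qed.

Lemma mid_VS m b (w : m.-tuple 'I_4) : mid b w \in V s m.+1.
Proof.
case: b; [rewrite -(xl_rcons w); apply: (xl_V [tuple of rcons w letter1])|].
by rewrite -(xl_rcons w); apply: (xl_V [tuple of rcons w letter4]).
Qed.

End Graph.

(** * Energies *)

Section Energy.
Variables (R : realType) (s : R).
Hypotheses (s_gt0 : 0 < s) (s_le : s <= 8^-1).
Implicit Types (p q x y : plane R) (w v : seq 'I_4) (f : plane R -> R).
Local Notation xl := (xl s).
Local Notation xr := (xr s).
Local Notation mid := (mid s).

Definition incr f w := f (xr w) - f (xl w).

Lemma energyE m f :
  energy s m (ofreal f) = \sum_(w : m.-tuple 'I_4) incr f w ^+ 2.
Proof.
have nE (t u : R) : complex.Re `|t%:C - u%:C|%C = `|t - u|.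
  by rewrite -rmorphB normc_def /= expr0n addr0 sqrtr_sqr.
rewrite /energy (sum_adjacent s_gt0 s_le m
  (fun x y => complex.Re (`|ofreal f x - ofreal f y|) ^+ 2)) mulr_sumr.
apply: eq_bigr => w _; rewrite /ofreal !nE !real_normK ?num_real// /incr; by field.
Qed.

Lemma energyS m f : energy s m.+1 (ofreal f) = energy s m (ofreal f) +
  2 * \sum_(w : m.-tuple 'I_4) \sum_b (f (mid b w) - (f (xl w) + f (xr w)) / 2) ^+ 2.
Proof.
rewrite !energyE (sum_tuple_rcons m (fun w => incr f w ^+ 2)).
rewrite mulr_sumr -big_split /=; apply: eq_bigr => w _.
by rewrite sum_letters big_bool /incr !xl_rcons !xr_rcons /=; field.
Qed.

Lemma energy_le m n f : (m <= n)%N -> energy s m (ofreal f) <= energy s n (ofreal f).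
Proof.
move=> /subnK <-; elim: (n - m)%N => // k IH; rewrite addSn energyS.
apply: le_trans IH _; rewrite lerDl mulr_ge0// sumr_ge0// => w _.
by apply: sumr_ge0 => b _; exact: sqr_ge0.
Qed.

Lemma bounded_in_domain f (K : R) :
  (forall m, energy s m (ofreal f) <= K) -> in_domain s (ofreal f).
Proof.
move=> fK; apply: nondecreasing_is_cvgn; first by move=> m n; exact: energy_le.
by exists K => _ [m _ <-].
Qed.

Definition midpoint_at m f := forall n (w : n.-tuple 'I_4) b, (m <= n)%N ->
  f (mid b w) = (f (xl w) + f (xr w)) / 2.

Lemma harmonic_midpoint m f : harmonic_at s m (ofreal f) -> midpoint_at m f.
Proof.
move=> [_ fE] n w b mn; have := energyS n f; rewrite !fE ?leqW//.
move/eqP; rewrite -subr_eq0 opprD addrA subrr add0r oppr_eq0 mulf_eq0 pnatr_eq0 /=.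
rewrite psumr_eq0; last by move=> v _; apply: sumr_ge0 => c _; exact: sqr_ge0.
move=> /allP /(_ w); rewrite mem_index_enum => /(_ isT) /=.
rewrite psumr_eq0; last by move=> c _; exact: sqr_ge0.
move=> /allP /(_ b); rewrite mem_index_enum => /(_ isT) /=.
by rewrite sqrf_eq0 subr_eq0 => /eqP.
Qed.

Lemma midpoint_in_domain m f : midpoint_at m f -> in_domain s (ofreal f).
Proof.
move=> fm; apply: (@bounded_in_domain _ (energy s m (ofreal f))) => n.
have [mn|/ltnW] := leqP m n; last exact: energy_le.
rewrite -(subnK mn); elim: (n - m)%N => // k IH.
rewrite addSn energyS big1 ?mulr0 ?addr0// => w _.
by rewrite big1// => b _; rewrite (fm _ w) ?leq_addl// subrr expr0n.
Qed.

Lemma midpoint_le m n f : (m <= n)%N -> midpoint_at m f -> midpoint_at n f.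
Proof. by move=> mn fm k w b nk; apply: fm; exact: leq_trans nk. Qed.

Lemma midpoint_lin m f g (c : R) : midpoint_at m f -> midpoint_at m g ->
  midpoint_at m (fun x => f x + c * g x).
Proof. by move=> fm gm n w b mn; rewrite fm// gm//; field. Qed.

Lemma midpoint_incr_rcons m f n (w : n.-tuple 'I_4) i : midpoint_at m f ->
  (m <= n)%N -> incr f (rcons w i) = incr f w / 2.
Proof.
move=> fm mn; move: i; apply: lettersP.
all: by rewrite /incr !xl_rcons !xr_rcons (fm _ w)//; field.
Qed.

Lemma midpoint_incr_cat m f v u : midpoint_at m f -> (m <= size v)%N ->
  incr f (v ++ u) = incr f v / 2 ^+ size u.
Proof.
move=> fm; elim/last_ind: u => [|u i IH] mv; first by rewrite cats0 expr0 divr1.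
rewrite -rcons_cat (midpoint_incr_rcons (in_tuple (v ++ u)) i fm).
  by rewrite IH// size_rcons exprS; field.
by rewrite size_cat (leq_trans mv)// leq_addr.
Qed.

(* The first coordinate is harmonic at scale 0 and serves as reference in the pairings below. *)
Lemma midpoint_fst : midpoint_at 0 fst.
Proof.
move=> n w b _; rewrite /mid /xl /xr; elim: (tval w) => [|i v IH].
  by case: b => /=; lra.
rewrite !word_map_cons.
by move: i; apply: lettersP; rewrite !letter_mapE /= IH; field.
Qed.

Lemma incr_fst w : incr fst w = 2 / 2 ^+ size w.
Proof.
rewrite -[w in LHS]cat0s (midpoint_incr_cat w midpoint_fst)//.
by rewrite /incr /=; congr (_ / _); lra.
Qed.

Lemma incr_snd w : `|incr snd w| <= 4 / 2 ^+ size w.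
Proof.
rewrite /incr; elim: w => [|i w]; first by rewrite /= subrr normr0 expr0; lra.
have := incr_fst w; rewrite /incr /xl /xr !word_map_cons /size -/size exprS invfM.
move: (word_map s w (vright R)) (word_map s w (vleft R)) => x y fE sE.
have {sE} : `|2 * s * (x.2 - y.2)| <= (2 ^+ size w)^-1.
  rewrite normrM normrM normr_nat (gtr0_norm s_gt0).
  have : 0 <= (8^-1 - s) * `|x.2 - y.2| by rewrite mulr_ge0 ?subr_ge0.
  by move: sE; move: `|_ - _| => d; lra.
rewrite !ler_norml => /andP[h1 h2].
move: i; apply: lettersP; rewrite !letter_mapE /=; apply/andP; split; lra.
Qed.

Definition l1_lipschitz (K : R) f := forall x y,
  `|f x - f y| <= K * (`|x.1 - y.1| + `|x.2 - y.2|).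

Lemma lipschitz_in_domain (K : R) f : 0 <= K -> l1_lipschitz K f -> in_domain s (ofreal f).
Proof.
move=> K0 fK; apply: (@bounded_in_domain _ (36 * K ^+ 2)) => m; rewrite energyE.
have bound (w : m.-tuple 'I_4) : incr f w ^+ 2 <= 36 * K ^+ 2 / 4 ^+ m.
  have := fK (xr w) (xl w); have := incr_snd w; have := incr_fst w.
  rewrite size_tuple /incr => -> sE fE.
  rewrite -(@real_normK _ (f _ - _)) ?num_real//.
  have -> : 4 ^+ m = (2 ^+ m) ^+ 2 :> R by rewrite -exprM mulnC exprM; congr (_ ^+ _); lra.
  have -> : 36 * K ^+ 2 / (2 ^+ m) ^+ 2 = (6 * K / 2 ^+ m) ^+ 2.
    by rewrite !exprMn exprVn; congr (_ * _ / _); lra.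
  rewrite lerXn2r ?nnegrE ?mulr_ge0 ?invr_ge0 ?exprn_ge0//.
  move: fE; rewrite (@ger0_norm _ (2 / _)) ?divr_ge0 ?exprn_ge0//.
  have : 0 <= K * (4 / 2 ^+ m - `|(xr w).2 - (xl w).2|) by rewrite mulr_ge0 ?subr_ge0.
  by lra.
apply: (@le_trans _ _ (\sum_(w : m.-tuple 'I_4) (36 * K ^+ 2 / 4 ^+ m))).
  by apply: ler_sum => w _; exact: bound.
by rewrite sumr_const card_tuple card_ord -[leLHS]mulr_natr natrX mulfVK.
Qed.

Lemma energy_densityE m f phi :
  complex.Re (energy_form s m (fun x => ofreal f x * ofreal phi x) (ofreal f)
    - 2^-1 * energy_form s m (fun x => ofreal f x * (ofreal f x)^*) (ofreal phi)) =
  \sum_(w : m.-tuple 'I_4) (phi (xl w) + phi (xr w)) / 2 * incr f w ^+ 2.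
Proof.
have real_conj (r : R) : ((r%:C)%C^*)%R = (r%:C)%C by exact: conjc_real.
rewrite /energy_form (sum_adjacent s_gt0 s_le m (fun x y =>
  (ofreal f x * ofreal phi x - ofreal f y * ofreal phi y) *
  (ofreal f x - ofreal f y)^*)).
rewrite (sum_adjacent s_gt0 s_le m (fun x y =>
  (ofreal f x * (ofreal f x)^* - ofreal f y * (ofreal f y)^*) *
  (ofreal phi x - ofreal phi y)^*)).
rewrite !mulr_sumr -sumrB raddf_sum; apply: eq_bigr => w _.
have half : (2^-1 : R[i]) = ((2^-1 : R)%:C)%C by rewrite fmorphV rmorph_nat.
rewrite half /ofreal !real_conj -!rmorphM -!rmorphB !real_conj -!rmorphM -!rmorphD.
by rewrite -!rmorphM -!rmorphB /= /incr; field.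
Qed.


End Energy.

Section PlaneTopology.
Variable R : realType.
Implicit Types (p q x y : plane R) (f : plane R -> R).

Lemma l1_lipschitz_continuous (K : R) f : l1_lipschitz K f -> continuous f.
Proof.
move=> fK x; apply/cvgrPdist_lt => e e0.
have K1 : 0 < `|K| + 1 by rewrite ltr_wpDl.
near=> y.
have : `|x - y| < e / (2 * (`|K| + 1)).
  near: y; apply: cvgr_dist_lt; last by rewrite divr_gt0 ?mulr_gt0.
  exact: cvg_id.
rewrite prod_normE /= gt_max ltr_pdivlMr ?mulr_gt0// ltr_pdivlMr ?mulr_gt0// => /andP[h1 h2].
apply: le_lt_trans (fK x y) _.
apply: (@le_lt_trans _ _ ((`|K| + 1) * (`|x.1 - y.1| + `|x.2 - y.2|))); last by lra.
by rewrite ler_wpM2r ?addr_ge0// ler_wpDr// ler_norm.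
Unshelve. all: by end_near.
Qed.

Lemma continuous_plane (F : plane R -> plane R) :
  continuous (fst \o F) -> continuous (snd \o F) -> continuous F.
Proof.
move=> F1 F2; have -> : F = (fun x => ((fst \o F) x, (snd \o F) x)).
  by apply/funext => x /=; case: (F x).
by move=> x; exact: (cvg_pair (F1 x) (F2 x)).
Qed.

Lemma plane_open_measurable (U : set (plane R)) : open U -> measurable U.
Proof.
move=> oU; pose rect (a : rat * rat * (rat * rat)) : set (plane R) :=
  `]ratr a.1.1, ratr a.1.2[%classic `*` `]ratr a.2.1, ratr a.2.2[%classic.
rewrite (_ : U = \bigcup_a (if `[< rect a `<=` U >] then rect a else set0)); last first.
  apply/seteqP; split=> [p Up|p [a _]]; last by case: asboolP => // aU /aU.
  have /nbhs_ballP[e /= e0 eU] : nbhs p U by exact: open_nbhs_nbhs.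
  have lt1 z : z - e < z by rewrite ltrBlDr ltrDl.
  have lt2 z : z < z + e by rewrite ltrDl.
  have [a1] := rat_in_itvoo (lt1 p.1); rewrite in_itv /= => /andP[a1l a1r].
  have [b1] := rat_in_itvoo (lt2 p.1); rewrite in_itv /= => /andP[b1l b1r].
  have [a2] := rat_in_itvoo (lt1 p.2); rewrite in_itv /= => /andP[a2l a2r].
  have [b2] := rat_in_itvoo (lt2 p.2); rewrite in_itv /= => /andP[b2l b2r].
  have subU : rect (a1, b1, (a2, b2)) `<=` U.
    move=> q [/=]; rewrite !in_itv /= => /andP[h1 h2] /andP[h3 h4]; apply: eU.
    by split; rewrite /ball /= ltr_norml; apply/andP; split; lra.
  exists (a1, b1, (a2, b2)) => //; rewrite asboolT//.
  by split; rewrite /= in_itv /=; apply/andP.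
apply: countable_bigcupT_measurable => [|a]; first exact: countableP.
by case: asboolP => // _; apply: measurableX; exact: measurable_itv.
Qed.

Lemma plane_closed_measurable (U : set (plane R)) : closed U -> measurable U.
Proof. by move=> /closed_openC/plane_open_measurable/measurableC; rewrite setCK. Qed.

Lemma plane_continuous_measurable f : continuous f -> measurable_fun setT f.
Proof.
move=> /continuousP cf; apply: (measurability _ (RGenOpens.measurableE R)).
move=> _ [_ [a [b ->] <-]]; rewrite setTI; apply: plane_open_measurable.
exact/cf/interval_open.
Qed.

End PlaneTopology.

(** * Test functions and the attractor *)

Section TestFunctions.
Variables (R : realType) (s : R).
Hypotheses (s_gt0 : 0 < s) (s_le : s <= 8^-1).
Implicit Types (p q x y : plane R) (w v u : seq 'I_4).
Local Notation xl := (xl s).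
Local Notation xr := (xr s).

Definition letter_inv (i : 'I_4) p : plane R :=
  let x := 2 * (p.1 - (letter_map s i 0).1) in
  (x, (2 * (p.2 - (letter_map s i 0).2) - (-1) ^+ i.+1 * x) / (4 * s)).

Lemma letter_mapK i : cancel (letter_map s i) (letter_inv i).
Proof.
have s0 : s != 0 by rewrite gt_eqF.
move=> [x y]; rewrite /letter_inv /letter_map /diamond_map /=.
move: (_ * cos _) (_ * sin _) ((-1) ^+ _) => a b c.
by apply: injective_projections => /=; field.
Qed.

Lemma letter_invK i : cancel (letter_inv i) (letter_map s i).
Proof.
have s0 : s != 0 by rewrite gt_eqF.
move=> [x y]; rewrite /letter_inv /letter_map /diamond_map /=.
move: (_ * cos _) (_ * sin _) ((-1) ^+ _) => a b c.
by apply: injective_projections => /=; field.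
Qed.

Definition hat p : R := Num.max 0 (1 - gauge p).

(* test v is hat transported to the cell of v: it vanishes off the interior of that cell. *)
Definition test v : plane R -> R := foldr (fun i f => f \o letter_inv i) hat v.

Lemma test_word_map v p : test v (word_map s v p) = hat p.
Proof. by elim: v p => //= i v IH p; rewrite letter_mapK. Qed.

Lemma test_range v p : 0 <= test v p <= 1.
Proof.
elim: v p => [|i v IH] p /=; last exact: IH.
by rewrite /hat le_max lexx ge_max ler01 /= gerBl addr_ge0 ?divr_ge0.
Qed.

Lemma test_support v p : test v p != 0 -> exists2 q, gauge q < 1 & p = word_map s v q.
Proof.
elim: v p => [|i v IH] p /=.
  rewrite /hat /Num.max; case: ltrP => [h _|]; last by rewrite eqxx.
  by exists p => //; rewrite -subr_gt0.
by move=> /IH [q gq e]; exists q => //; rewrite -e letter_invK.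
Qed.

Lemma test_cell v u p q : (size u <= size v)%N -> gauge q <= 1 ->
  p = word_map s u q -> test v p != 0 -> u = take (size u) v.
Proof.
move=> uv gq pE /test_support [q' gq' pE'].
have gd := gauge_word_map_lt1 s_gt0 s_le (drop (size u) v) gq'.
apply/esym/(word_map_separated s_gt0 s_le _ gd gq).
  by rewrite size_takel.
by rewrite -word_map_cat cat_take_drop -pE'.
Qed.

Lemma test_prefix v w p q : (size v <= size w)%N -> gauge q <= 1 ->
  p = word_map s w q -> test v p != 0 -> v = take (size v) w.
Proof.
move=> vw gq pE ne0; have sz : size (take (size v) w) = size v by rewrite size_takel.
rewrite [LHS](_ : v = take (size (take (size v) w)) v); last by rewrite sz take_size.
apply/esym/(@test_cell v _ p (word_map s (drop (size v) w) q)) => //.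
- by rewrite sz.
- exact: gauge_word_map_le1.
- by rewrite -word_map_cat cat_take_drop.
Qed.

Lemma hat_lipschitz : l1_lipschitz 1 hat.
Proof.
move=> x y; rewrite mul1r /hat /gauge.
have := ler_dist_dist x.1 y.1; have := ler_dist_dist x.2 y.2.
rewrite !ler_norml => /andP[h1 h2] /andP[h3 h4]; have := normr_ge0 (x.2 - y.2).
have := normr_ge0 (x.1 - y.1).
rewrite /Num.max; case: ltrP => h5; case: ltrP => h6 h7 h8; apply/andP; split; lra.
Qed.

Lemma letter_inv_lipschitz i p q :
  `|(letter_inv i p).1 - (letter_inv i q).1| +
  `|(letter_inv i p).2 - (letter_inv i q).2| <=
  (2 + s^-1) * (`|p.1 - q.1| + `|p.2 - q.2|).
Proof.
have s0 : s != 0 by rewrite gt_eqF.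
have -> : (letter_inv i p).1 - (letter_inv i q).1 = 2 * (p.1 - q.1).
  by rewrite /letter_inv /=; ring.
have -> : (letter_inv i p).2 - (letter_inv i q).2 =
    (p.2 - q.2 - (-1) ^+ i.+1 * (p.1 - q.1)) * s^-1 / 2.
  rewrite /letter_inv; move: (letter_map s i 0) ((-1) ^+ i.+1) => b c /=.
  by field.
have si : 0 < s^-1 by rewrite invr_gt0.
rewrite !normrM normr_nat (gtr0_norm si) normfV normr_nat.
have : `|p.2 - q.2 - (-1) ^+ i.+1 * (p.1 - q.1)| <= `|p.2 - q.2| + `|p.1 - q.1|.
  by apply: le_trans (ler_normB _ _) _; rewrite normrM normrX normrN normr1 expr1n mul1r.
move: (normr_ge0 (p.2 - q.2)) (normr_ge0 (p.1 - q.1)).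
move: `|p.2 - q.2| `|p.1 - q.1| `|_ - _| => b a c b0 a0 /(ler_wpM2r (ltW si)).
have := mulr_ge0 b0 (ltW si); have := mulr_ge0 a0 (ltW si).
by lra.
Qed.

Lemma test_lipschitz v : exists2 K : R, 0 <= K & l1_lipschitz K (test v).
Proof.
elim: v => [|i v [K K0 IH]]; first by exists 1 => //; exact: hat_lipschitz.
have K0' : 0 <= 2 + s^-1 by rewrite addr_ge0// invr_ge0 ltW.
exists (K * (2 + s^-1)); first exact: mulr_ge0.
move=> x y; apply: le_trans (IH _ _) _; rewrite -mulrA ler_wpM2l//.
exact: letter_inv_lipschitz.
Qed.

Lemma test_continuous v : continuous (test v).
Proof. by have [K _ /l1_lipschitz_continuous] := test_lipschitz v. Qed.

Lemma test_in_domain v : in_domain s (ofreal (test v)).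
Proof. by have [K K0 /(lipschitz_in_domain s_gt0 s_le K0)] := test_lipschitz v. Qed.

Lemma letter_inv_continuous i : continuous (letter_inv i).
Proof.
have K x y := letter_inv_lipschitz i x y.
apply: continuous_plane; apply: (@l1_lipschitz_continuous _ (2 + s^-1)) => x y /=.
  by apply: le_trans (K x y); rewrite lerDl.
by apply: le_trans (K x y); rewrite lerDr.
Qed.

Lemma gauge_lipschitz : l1_lipschitz 1 (@gauge R).
Proof.
move=> x y; rewrite mul1r /gauge.
have := ler_dist_dist x.1 y.1; have := ler_dist_dist x.2 y.2.
rewrite !ler_norml => /andP[h1 h2] /andP[h3 h4]; have := normr_ge0 (x.2 - y.2).
by move=> h; apply/andP; split; lra.
Qed.

Variable X : set (plane R).
Hypothesis hX : is_attractor s X.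

Lemma attractor_gauge p : X p -> gauge p <= 1.
Proof.
have [cX X0 XE] := hX.
have : compact (@gauge R @` X).
  apply: continuous_compact => //; apply: continuous_subspaceT.
  exact: l1_lipschitz_continuous gauge_lipschitz.
move=> /compact_bounded [M [_ MX]].
have supX : has_sup (@gauge R @` X).
  split; first by case: X0 => q Xq; exists (gauge q), q.
  exists (M + 1) => _ [q Xq <-]; apply: le_trans (ler_norm _) _.
  by apply: MX; [rewrite ltrDl|exists q].
suff S1 : sup (@gauge R @` X) <= 1.
  by move=> Xp; apply: le_trans S1; apply: sup_upper_bound => //; exists p.
set S := sup _.
have : S <= Num.max ((3 + S) / 4) ((3 * S + 1) / 4).
  apply: ge_sup; first by case: supX.
  move=> _ [q + <-]; rewrite XE => -[i _ [r Xr <-]].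
  apply: le_trans (gauge_letter_map s_gt0 s_le i r) _.
  have rS : gauge r <= S by apply: sup_upper_bound => //; exists r.
  by rewrite ge_max !le_max; apply/andP; split; apply/orP; [left|right]; lra.
by rewrite le_max => /orP[]; lra.
Qed.

Lemma attractor_cells n p : X p -> exists u : n.-tuple 'I_4, cell s X u p.
Proof.
have [_ _ XE] := hX.
elim: n p => [|n IH] p; first by move=> Xp; exists [tuple], p.
rewrite {1}XE => -[i _ [q /IH [u [r Xr rq]] <-]].
by exists [tuple of i :: u], r => //=; rewrite rq.
Qed.

Lemma attractor_closed : closed X.
Proof.
by have [cX _ _] := hX; apply: compact_closed cX; exact: norm_hausdorff.
Qed.

Lemma cell_closed w : closed (cell s X w).
Proof.
elim: w => [|i w IH]; first by rewrite /cell /= image_id; exact: attractor_closed.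
rewrite (_ : cell s X (i :: w) = letter_inv i @^-1` cell s X w).
  by apply: closed_comp IH => p _; exact: letter_inv_continuous.
apply/seteqP; split=> [_ [q Xq <-]|p [q Xq qE]].
  by exists q => //=; rewrite letter_mapK.
by exists q => //=; rewrite qE letter_invK.
Qed.

Lemma attractor_measurable : measurable X.
Proof. exact: plane_closed_measurable attractor_closed. Qed.

Lemma indic_bounded_borel w : bounded_borel X (cell_indic s X w).
Proof.
have mc := plane_closed_measurable (@cell_closed w).
split; rewrite /cell_indic /ofreal /=.
- exact: measurable_indic.
- exact: measurable_cst.
exists 1 => p _; rewrite ?normc_def /= expr0n addr0 sqrtr_sqr /= indicE.
by case: (p \in _); rewrite ?normr0 ?normr1.
Qed.

Lemma test_bounded_borel v : bounded_borel X (ofreal (test v)).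
Proof.
split; rewrite /ofreal /=.
- apply: measurable_funTS; exact: plane_continuous_measurable (@test_continuous v).
- exact: measurable_cst.
exists 1 => p _; rewrite ?normc_def /= expr0n addr0 sqrtr_sqr /=.
by have /andP[h0 h1] := test_range v p; rewrite ger0_norm.
Qed.

Lemma indic_test m (u : m.-tuple 'I_4) v p : (m <= size v)%N -> X p ->
  \1_(cell s X u) p * test v p = if val u == take m v then test v p else 0.
Proof.
move=> mv Xp; have [->|t0] := eqVneq (test v p) 0; first by rewrite mulr0 if_same.
have inside (u' : m.-tuple 'I_4) : cell s X u' p -> val u' = take m v.
  move=> [q /attractor_gauge gq e].
  have := @test_cell v (val u') p q; rewrite size_tuple => /(_ mv gq); exact.
rewrite indicE; case: eqVneq => [uE|uN].
  have [u' cu'] := attractor_cells m Xp.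
  by rewrite (val_inj (etrans uE (esym (inside _ cu')))) mem_set// mul1r.
by rewrite memNset ?mul0r// => /inside uE; rewrite uE eqxx in uN.
Qed.

(* The pairing, through the energy density at scale n, of test v d(x_1) with a function that
   is harmonic at scale |v| and has increment 1 along the edge of v. *)
Definition mass v n : R := \sum_(w : n.-tuple 'I_4)
  (test v (xl w) + test v (xr w)) / 2 * ((2 / 2 ^+ n) / 2 ^+ (n - size v)).

Lemma sum_tuple_prefix n u (F : seq 'I_4 -> R) : (forall w, 0 <= F w) ->
  \sum_(w : n.-tuple 'I_4) F (u ++ w) <= \sum_(w : (size u + n).-tuple 'I_4) F w.
Proof.
move=> F0; elim: u F F0 => [|i u IH] F F0 //=.
rewrite (sum_tuple_cons _ F) (bigD1 i)//=.
apply: le_trans (IH (fun w => F (i :: w)) _) _ => //.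
by rewrite lerDl sumr_ge0// => j _; rewrite sumr_ge0.
Qed.

(* The cell of the word 2 1 1 stays away from the boundary of the rhombus. *)
Lemma hat_inside p : gauge p <= 1 -> 4^-1 <= hat (word_map s [:: letter2; letter1; letter1] p).
Proof.
move=> gp; rewrite word_map_cons; set r := word_map s _ p.
have gr : gauge r <= 1 by exact: gauge_word_map_le1.
have r1 : 2^-1 <= r.1.
  rewrite /r !word_map_cons !letter_mapE /=.
  move: gp; rewrite /gauge; have := ler_norm (- p.1); have := normr_ge0 p.2.
  by rewrite normrN; lra.
rewrite /hat le_max; apply/orP; right; move: gr; rewrite /gauge letter_mapE /=.
have : 0 <= (8^-1 - s) * `|r.2| by rewrite mulr_ge0 ?subr_ge0.
have := ler_normD ((1 + r.1) / 2) (2 * s * r.2).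
rewrite !normrM !normfV !normr_nat (gtr0_norm s_gt0) (@ger0_norm _ r.1); last by lra.
rewrite (@ger0_norm _ (1 + r.1)); last by lra.
move=> h1 h2 h3; have r1' : r.1 <= 1 by have := normr_ge0 r.2; lra.
by rewrite (@ler0_norm _ (r.1 - 1)); lra.
Qed.

Lemma mass_ge v : exists2 c, 0 < c & forall n, (size v + 3 <= n)%N -> c <= mass v n.
Proof.
exists (128 * 2 ^+ size v)^-1; first by rewrite invr_gt0 mulr_gt0 ?exprn_gt0.
move=> n; set u := v ++ [:: letter2; letter1; letter1].
have <- : size u = (size v + 3)%N by rewrite size_cat.
move=> /subnK; rewrite addnC; move: (n - size u)%N => k <-; rewrite /mass.
have ge0 w : 0 <= (test v (xl w) + test v (xr w)) / 2 *
    ((2 / 2 ^+ (size u + k)) / 2 ^+ (size u + k - size v)).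
  have /andP[h1 _] := test_range v (xl w); have /andP[h2 _] := test_range v (xr w).
  by rewrite mulr_ge0 ?divr_ge0 ?addr_ge0 ?exprn_ge0.
apply: le_trans (@sum_tuple_prefix k u _ ge0).
have big w : 4^-1 <= (test v (xl (u ++ w)) + test v (xr (u ++ w))) / 2.
  have inside p : gauge p <= 1 -> 4^-1 <= test v (word_map s (u ++ w) p).
    move=> gp; rewrite -catA word_map_cat test_word_map word_map_cat.
    by apply: hat_inside; exact: gauge_word_map_le1.
  have := inside (vleft R); have := inside (vright R); rewrite !gauge_V0 /xl /xr.
  by move=> /(_ (lexx _)) h1 /(_ (lexx _)) h2; lra.
apply: (@le_trans _ _ (\sum_(w : k.-tuple 'I_4)
    (4^-1 * (2 / 2 ^+ (size u + k) / 2 ^+ (size u + k - size v))))); last first.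
  by apply: ler_sum => w _; rewrite ler_wpM2r ?divr_ge0 ?exprn_ge0.
rewrite sumr_const card_tuple card_ord -[leRHS]mulr_natr natrX.
have -> : (size u + k - size v = 3 + k)%N by rewrite size_cat -addnA addKn.
rewrite size_cat !exprD (_ : 4%:R ^+ k = 2 ^+ k * 2 ^+ k); last first.
  by rewrite -exprMn; congr (_ ^+ _); lra.
have k0 : 2 ^+ k != 0 :> R by rewrite expf_neq0.
have v0 : 2 ^+ size v != 0 :> R by rewrite expf_neq0.
move: (2 ^+ k) (2 ^+ size v) k0 v0 => a b a0 b0.
by rewrite le_eqVlt; apply/orP; left; apply/eqP => /=; field; rewrite a0 b0.
Qed.

End TestFunctions.

(** * Edge functions of 1-forms *)

Lemma cvg_fsum (R : realType) (I : finType) (F : I -> nat -> R) (l : I -> R) :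
  (forall i, F i @ \oo --> l i) -> (fun n => \sum_i F i n) @ \oo --> \sum_i l i.
Proof.
move=> Fl; have -> : (fun n => \sum_i F i n) = \sum_i F i.
  by apply/funext => n; rewrite fct_sumE.
apply: (big_ind2 (fun (f : nat -> R) a => f @ \oo --> a)) => [|f a g b fa gb|i _].
- exact: cvg_cst.
- exact: cvgD.
- exact: Fl.
Qed.

Section Pairing.
Variables (R : realType) (s : R).
Hypotheses (s_gt0 : 0 < s) (s_le : s <= 8^-1).
Variables (X : set (plane R)) (H : lmodType R[i]) (ip : H -> H -> R[i]).
Variable tensor : (plane R -> R[i]) -> (plane R -> R[i]) -> H.
Hypotheses (hX : is_attractor s X) (hH : is_oneform_space s X ip tensor).
Implicit Types (v : seq 'I_4) (A f phi : plane R -> R).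
Local Notation xl := (xl s).
Local Notation xr := (xr s).
Local Notation incr := (incr s).

Let density v f n := \sum_(w : n.-tuple 'I_4)
  (test s v (xl w) + test s v (xr w)) / 2 * incr f w ^+ 2.

Let Re_quarter_sum (r : 'I_4 -> R) :
  complex.Re (4^-1 * \sum_(k < 4) 'i%C ^+ k * ((r k)%:C)%C : R[i]) = 4^-1 * (r letter1 - r letter3).
Proof.
have -> : 4^-1 = ((4^-1 : R)%:C)%C :> R[i] by rewrite fmorphV rmorph_nat.
rewrite (sum_letters (fun k : 'I_4 => 'i%C ^+ k * ((r k)%:C)%C)) /=.
ring.
Qed.

Let mutual_integral_Re Gam (g : plane R -> R) f f' :
  complex.Re (mutual_integral X Gam (ofreal g) (ofreal f) (ofreal f')) =
  4^-1 * (\int[Gam (ofreal (fun x => f x + 1 * f' x))]_(x in X) g x -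
          \int[Gam (ofreal (fun x => f x + (-1) * f' x))]_(x in X) g x).
Proof.
have E nu : cintegral X nu (ofreal g) = ((\int[nu]_(x in X) g x)%:C)%C.
  by rewrite /cintegral /ofreal /= Rintegral_cst ?mul0r//; exact: (attractor_measurable hX).
rewrite /mutual_integral; under eq_bigr do rewrite E.
rewrite (Re_quarter_sum (fun k =>
  \int[Gam (fun x => ofreal f x + 'i%C ^+ k * ofreal f' x)]_(x in X) g x)) /=.
have cE (c : R) (z : R[i]) : z = (c%:C)%C ->
    (fun x => ofreal f x + z * ofreal f' x) = ofreal (fun x => f x + c * f' x).
  by move=> ->; apply/funext => x; rewrite /ofreal rmorphD rmorphM.
rewrite (cE 1 ('i%C ^+ letter1)) ?(cE (-1) ('i%C ^+ letter3)) //=;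
  by rewrite ?expr0 ?sqr_i ?rmorphN ?rmorph1.
Qed.

Lemma pairing_cvg v m (u : m.-tuple 'I_4) A : (m <= size v)%N ->
  harmonic_at s m (ofreal A) ->
  (fun n => (if val u == take m v then incr A v else 0) * mass s v n) @ \oo -->
    complex.Re (ip (tensor (ofreal A) (cell_indic s X u))
                   (tensor (ofreal fst) (ofreal (test s v)))).
Proof.
move=> mv hA; have [_ [Gam [GamE ipE]] _] := hH.
have Am := harmonic_midpoint s_gt0 s_le hA.
have fm : midpoint_at s m fst := midpoint_le (leq0n m) (midpoint_fst s).
have dom c : in_domain s (ofreal (fun x => A x + c * fst x)).
  exact: (midpoint_in_domain s_gt0 s_le (midpoint_lin c Am fm)).
have dom1 := midpoint_in_domain s_gt0 s_le fm.
rewrite ipE//; [|by case: hA|exact: indic_bounded_borel|exact: test_bounded_borel].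
rewrite (_ : (fun x => _) = ofreal (fun x => \1_(cell s X u) x * test s v x)); last first.
  apply/funext => x; rewrite /ofreal /cell_indic /ofreal rmorphM; congr (_ * _).
  exact: conjc_real.
rewrite mutual_integral_Re.
have intE (nu : {finite_measure set (plane R) -> \bar R}) :
    \int[nu]_(x in X) (\1_(cell s X u) x * test s v x) =
    if val u == take m v then \int[nu]_(x in X) test s v x else 0.
  rewrite (@eq_Rintegral _ _ _ _ _ (fun x => if val u == take m v then test s v x else 0)).
    case: ifP => // _; rewrite Rintegral_cst ?mul0r//; exact: (attractor_measurable hX).
  by move=> x; rewrite inE => Xx; exact: indic_test.
rewrite !intE; case: ifP => _; last first.
  rewrite subrr mulr0; apply: cvg_near_cst; apply: nearW => k; rewrite mul0r//.
have lim c : density v (fun x => A x + c * fst x) @ \oo -->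
    \int[Gam (ofreal (fun x => A x + c * x.1))]_(x in X) test s v x.
  have [_ _ G] := GamE _ (dom c).
  have cont : {within X, continuous (test s v)}.
    by apply: continuous_subspaceT; exact: test_continuous.
  have := G _ cont (@test_in_domain _ _ s_gt0 s_le v).
  apply: cvg_trans; apply: near_eq_cvg; apply: nearW => n.
  exact: energy_densityE.
apply: (@cvg_trans _ ((fun n => 4^-1 * (density v (fun x => A x + 1 * fst x) n
    - density v (fun x => A x + (-1) * fst x) n)) @ \oo)); last first.
  by apply: cvgMr; apply: cvgB; exact: lim.
apply: near_eq_cvg; near=> n.
have vn : (size v <= n)%N by near: n; exact: nbhs_infty_ge.
rewrite /mass /density /= -sumrB !mulr_sumr; apply: eq_bigr => w _.
have incrD c : incr (fun x => A x + c * x.1) w = incr A w + c * incr fst w.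
  by rewrite /incr; ring.
rewrite !incrD incr_fst size_tuple.
have : (test s v (xl w) + test s v (xr w)) * incr A w =
       (test s v (xl w) + test s v (xr w)) * (incr A v / 2 ^+ (n - size v)).
  have incrA : v = take (size v) w -> incr A w = incr A v / 2 ^+ (n - size v).
    move=> e; rewrite -[in LHS](cat_take_drop (size v) w) -e.
    by rewrite (midpoint_incr_cat _ Am)// size_drop size_tuple.
  have [l0|l0] := eqVneq (test s v (xl w)) 0; last first.
    rewrite incrA//; apply: (test_prefix s_gt0 s_le _ _ (erefl (xl w)) l0).
      by rewrite size_tuple.
    by rewrite gauge_V0.
  have [r0|r0] := eqVneq (test s v (xr w)) 0; last first.
    rewrite incrA//; apply: (test_prefix s_gt0 s_le _ _ (erefl (xr w)) r0).
      by rewrite size_tuple.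
    by rewrite gauge_V0.
  by rewrite l0 r0 addr0 !mul0r.
move: (test s v _ + _) (2 / 2 ^+ n) => t g e.
transitivity (t * incr A w * g / 2); first by field.
by rewrite e; field; rewrite expf_neq0.
Unshelve. all: by end_near.
Qed.

Let ipD (u v w : H) : ip (u + v) w = ip u w + ip v w.
Proof. by case: hH => -[lin _ _ _ _] _ _; rewrite -{1}[u]scale1r lin mul1r. Qed.

Let ip0 (w : H) : ip 0 w = 0.
Proof. by apply: (addrI (ip 0 w)); rewrite -ipD !addr0. Qed.

Let ipZ c (u w : H) : ip (c *: u) w = c * ip u w.
Proof. by case: hH => -[lin _ _ _ _] _ _; rewrite -[c *: u]addr0 lin ip0 addr0. Qed.

Let ip_sum (I : finType) (F : I -> H) (w : H) : ip (\sum_i F i) w = \sum_i ip (F i) w.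
Proof. by apply: (big_morph (fun u => ip u w)) => [u v|]; [exact: ipD|exact: ip0]. Qed.

(* Pairing with d(x_1) times test v reads off the edge function on the edge of v, whatever
   the scale m <= |v|; this makes edge functions of different scales comparable. *)
Lemma edge_function_cvg m (b : H) (th : plane R -> plane R -> R) v :
  is_edge_function s X tensor m b th -> (m <= size v)%N ->
  (fun n => th (xl (take m v)) (xr (take m v)) / 2 ^+ (size v - m) * mass s v n) @ \oo -->
    complex.Re (ip b (tensor (ofreal fst) (ofreal (test s v)))).
Proof.
move=> [A [hA -> thE]] mv; rewrite ip_sum raddf_sum /=.
pose w0 := Tuple (introT eqP (size_takel mv)).
have w0E : val w0 = take m v by [].
apply: (@cvg_trans _ ((fun n => \sum_(w : m.-tuple 'I_4)
    (if val w == take m v then incr (A w) v else 0) * mass s v n) @ \oo)); last first.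
  by apply: cvg_fsum => w; apply: pairing_cvg.
apply: near_eq_cvg; apply: nearW => n.
rewrite (bigD1 w0)//= big1 ?addr0 => [|w ww0]; last first.
  by rewrite -w0E (inj_eq val_inj) (negbTE ww0) mul0r.
rewrite eqxx (thE w0); last by rewrite is_edgeE// !eqxx.
have := midpoint_incr_cat (drop m v) (harmonic_midpoint s_gt0 s_le (hA w0)).
move=> /(_ (take m v)); rewrite cat_take_drop size_takel// => ->//.
by rewrite size_drop.
Qed.

Lemma edge_function_step m (b1 b0 : H) (th1 th0 : plane R -> plane R -> R)
    (beta : R) (k : m.-tuple 'I_4 -> H) (th : m.-tuple 'I_4 -> plane R -> plane R -> R)
    (w : m.-tuple 'I_4) i :
  is_edge_function s X tensor m.+1 b1 th1 -> is_edge_function s X tensor m b0 th0 ->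
  (forall u, is_edge_function s X tensor m.+1 (k u) (th u)) ->
  b1 = b0 + (beta%:C)%C *: \sum_u k u ->
  th1 (xl (rcons w i)) (xr (rcons w i)) =
    th0 (xl w) (xr w) / 2 + beta * \sum_u th u (xl (rcons w i)) (xr (rcons w i)).
Proof.
move=> h1 h0 hk bE; set v := rcons w i.
have sv : size v = m.+1 by rewrite size_rcons size_tuple.
have take0 : take m v = w by rewrite /v -cats1 take_size_cat ?size_tuple.
have take1 : take m.+1 v = v by rewrite -sv take_size.
have lim1 b' th' : is_edge_function s X tensor m.+1 b' th' ->
    (fun n => th' (xl v) (xr v) * mass s v n) @ \oo -->
    complex.Re (ip b' (tensor (ofreal fst) (ofreal (test s v)))).
  move=> /(@edge_function_cvg _ _ _ v); rewrite sv leqnn take1 subnn expr0 divr1.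
  exact.
have lim0 : (fun n => th0 (xl w) (xr w) / 2 * mass s v n) @ \oo -->
    complex.Re (ip b0 (tensor (ofreal fst) (ofreal (test s v)))).
  by have := @edge_function_cvg _ _ _ v h0; rewrite sv leqnSn take0 subSnn expr1; exact.
pose d := th1 (xl v) (xr v) -
  (th0 (xl w) (xr w) / 2 + beta * \sum_u th u (xl v) (xr v)).
suff : d = 0 by move/eqP; rewrite subr_eq0 => /eqP.
have : (fun n => d * mass s v n) @ \oo --> (0 : R).
  have -> : (fun n => d * mass s v n) = (fun n => th1 (xl v) (xr v) * mass s v n -
      (th0 (xl w) (xr w) / 2 * mass s v n +
       beta * \sum_u th u (xl v) (xr v) * mass s v n)).
    by apply/funext => n; rewrite -mulr_suml /d; ring.
  rewrite [X in _ --> X](_ : (0 : R) =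
      complex.Re (ip b1 (tensor (ofreal fst) (ofreal (test s v)))) -
      (complex.Re (ip b0 (tensor (ofreal fst) (ofreal (test s v)))) +
       beta * \sum_u complex.Re (ip (k u) (tensor (ofreal fst) (ofreal (test s v)))))); last first.
    rewrite bE ipD ipZ ip_sum raddfD /= -raddf_sum; move: (\sum_u ip _ _) => [z z'] /=.
    by ring.
  apply: cvgB; first exact: lim1.
  apply: cvgD; first exact: lim0.
  by apply: cvgMr; apply: cvg_fsum => u; apply: lim1.
have [c c0 mc] := mass_ge s_gt0 s_le v.
move=> /cvgrPdist_lt dlim; apply/eqP/negPn/negP => d0.
have /dlim : 0 < `|d| * c by rewrite mulr_gt0 ?normr_gt0.
move=> /(filterI (nbhs_infty_ge (size v + 3)%N)) /filter_ex [n [/mc mn]].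
rewrite sub0r normrN normrM (@ger0_norm _ (mass s v n)); last exact: le_trans (ltW c0) mn.
by rewrite ltr_pM2l ?normr_gt0// ltNge mn.
Qed.

End Pairing.

Section Loops.
Variables (R : realType) (s : R).
Hypotheses (s_gt0 : 0 < s) (s_le : s <= 8^-1).
Implicit Types (x y z : plane R).
Local Notation xl := (xl s).
Local Notation xr := (xr s).
Local Notation mid := (mid s).

Lemma mem_loop_from m b (w u : m.-tuple 'I_4) z : z \in V s m ->
  ((mid b w, z) \in loop_edges s u) = (u == w) && (z == if b then xl w else xr w).
Proof.
move=> zV; have sz : size w = size u by rewrite !size_tuple.
have midE c : (mid b w == mid c u) = (b == c) && (u == w).
  apply/eqP/andP => [/(mid_inj s_gt0 s_le sz) [-> /val_inj ->] //|[/eqP -> /eqP -> //]].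
rewrite /loop_edges !inE !xpair_eqE -/(xl u) -/(xr u) -/(mid true u) -/(mid false u).
rewrite (negbTE (mid_neq_xl s_gt0 s_le b sz)) (negbTE (mid_neq_xr s_gt0 s_le b sz)) /= !midE.
by case: (eqVneq u w) => [->|_]; case: b {midE}; rewrite /= ?andbF ?orbF.
Qed.

Lemma mem_loop_to m b (w u : m.-tuple 'I_4) z : z \in V s m ->
  ((z, mid b w) \in loop_edges s u) = (u == w) && (z == if b then xr w else xl w).
Proof.
move=> zV; have sz : size w = size u by rewrite !size_tuple.
have midE c : (mid b w == mid c u) = (b == c) && (u == w).
  apply/eqP/andP => [/(mid_inj s_gt0 s_le sz) [-> /val_inj ->] //|[/eqP -> /eqP -> //]].
rewrite /loop_edges !inE !xpair_eqE -/(xl u) -/(xr u) -/(mid true u) -/(mid false u).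
rewrite (negbTE (mid_neq_xl s_gt0 s_le b sz)) (negbTE (mid_neq_xr s_gt0 s_le b sz)) /= !midE.
by case: (eqVneq u w) => [->|_]; case: b {midE}; rewrite /= ?andbF ?andbT ?orbF.
Qed.

Lemma sum_loop m (w : m.-tuple 'I_4) i :
  \sum_(u : m.-tuple 'I_4) loop_function s u (xl (rcons w i)) (xr (rcons w i)) =
  if (i < 2)%N then - 1 else 1.
Proof.
have E (c : R) (F : m.-tuple 'I_4 -> R) :
    (forall u, F u = if u == w then c else 0) -> \sum_u F u = c.
  by move=> FE; rewrite (bigD1 w)//= FE eqxx big1 ?addr0// => u /negbTE uw; rewrite FE uw.
have [l r] := (xl_V s w, xr_V s w).
have lr := negbTE (xl_neq_xr s_gt0 w); have rl := lr; rewrite eq_sym in rl.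
apply: E => u; rewrite /loop_function; move: i; apply: lettersP.
all: rewrite ?xl_rcons ?xr_rcons ?mem_loop_from ?mem_loop_to ?eqxx //=.
all: rewrite ?lr ?rl ?eqxx ?andbF ?andbT.
all: by case: (u == w); rewrite /= ?mulr1n ?mulr0n ?sub0r ?subr0 ?oppr0.
Qed.

End Loops.

(** * Magnetic operators *)

Lemma linear_pencil (K : comNzRingType) (U : lmodType K) (f : U -> U) (a b : K) :
  linear f -> linear (fun u => a *: f u - b *: u).
Proof.
move=> f_lin k u v; rewrite f_lin !scalerDr scalerN !scalerA (mulrC a) (mulrC b).
by rewrite opprD addrACA.
Qed.

Section Linear.
Variables (K : fieldType) (vT : vectType K) (f : vT -> vT).
Hypothesis f_lin : linear f.

Let f_linear := GRing.isLinear.Build K vT vT *:%R f f_lin.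
Let F : {linear vT -> vT} := HB.pack f f_linear.

Lemma linear_inj_bij : (forall x, f x = 0 -> x = 0) ->
  exists g, cancel f g /\ cancel g f.
Proof.
move=> inj0; have k0 : lker (linfun F) == 0%VS.
  apply/eqP/vspaceP => x; rewrite memv_ker lfunE memv0 /=.
  by apply/eqP/eqP => [/inj0//|->]; exact: (linear0 F).
exists ((linfun F)^-1)%VF; split=> x.
  by have := lker0_lfunK k0 x; rewrite lfunE.
have surj : limg (linfun F) = fullv.
  apply/eqP; rewrite eqEdim subvf -[leqLHS](limg_ker_dim (linfun F)) capfv (eqP k0) dimv0.
  by rewrite add0n leqnn.
by have := limg_lfunVK (_ : x \in limg (linfun F)); rewrite surj memvf lfunE => /(_ isT).
Qed.

Lemma linear_surj_inj g : cancel g f -> cancel f g.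
Proof.
move=> gK; have inj : lker (linfun F) == 0%VS.
  rewrite -dimv_eq0; have := limg_ker_dim (linfun F) fullv.
  have -> : limg (linfun F) = fullv.
    apply/vspaceP => x; rewrite memvf; apply/memv_imgP; exists (g x); rewrite ?memvf//.
    by rewrite lfunE /= gK.
  by rewrite capfv => /eqP; rewrite -[X in _ == X]add0n eqn_add2r.
move=> x; apply: (lker0P inj); rewrite !lfunE /=; exact: gK.
Qed.

End Linear.

Section Averaging.
Variables (R : realType) (s : R).
Hypotheses (s_gt0 : 0 < s) (s_le : s <= 8^-1).
Implicit Types (theta : plane R -> plane R -> R).
Local Notation xl := (xl s).
Local Notation xr := (xr s).
Local Notation mid := (mid s).
Local Notation V := (V s).
Local Notation deg := (deg s).
Local Notation C := R[i].

Lemma expiD (a b : R) : expi (a + b) = expi a * expi b.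
Proof. by rewrite /expi cosD sinD; simpc; congr (_ +i* _)%C; ring. Qed.

Lemma expi0 : expi 0 = 1 :> C.
Proof. by rewrite /expi cos0 sin0. Qed.

Lemma norm_expi (a : R) : `|expi a| = 1.
Proof. by rewrite normc_def /= cos2Dsin2 sqrtr1. Qed.

Lemma expi_cos (a : R) : expi a + expi (- a) = 2 * ((cos a)%:C)%C.
Proof. by rewrite /expi cosN sinN; simpc; congr (_ +i* _)%C; ring. Qed.

Lemma adj_sym m x y : adj s m x y = adj s m y x.
Proof. by apply: eq_existsb => w; exact: is_edge_sym. Qed.

Lemma sum_neighbours_old (M : nmodType) m x (g : plane R -> M) : x \in V m ->
  \sum_(y : V m.+1 | adj s m.+1 x (val y)) g (val y) =
  \sum_(w : m.-tuple 'I_4)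
    ((if x == xl w then g (mid true w) + g (mid false w) else 0) +
     (if x == xr w then g (mid true w) + g (mid false w) else 0)).
Proof.
move=> xV; rewrite sum_neighbours//.
rewrite (sum_tuple_rcons m (fun w => (if x == xl w then g (xr w) else 0) +
  (if x == xr w then g (xl w) else 0))).
apply: eq_bigr => w _; rewrite sum_letters !xl_rcons !xr_rcons.
have xm b : (x == mid b w) = false.
  by apply/eqP => xE; have := mid_notin_V s_gt0 s_le b w; rewrite -xE xV.
rewrite !xm !add0r !addr0; case: (x == xl w); case: (x == xr w);
  by rewrite ?addr0 ?add0r // [RHS]addrACA !addrA.
Qed.

Lemma sum_neighbours_mid (M : nmodType) m b (w : m.-tuple 'I_4) (g : plane R -> M) :
  \sum_(y : V m.+1 | adj s m.+1 (mid b w) (val y)) g (val y) = g (xl w) + g (xr w).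
Proof.
rewrite sum_neighbours// (sum_tuple_rcons m (fun v =>
  (if mid b w == xl v then g (xr v) else 0) + (if mid b w == xr v then g (xl v) else 0))).
have sz u : size w = size (u : m.-tuple 'I_4) by rewrite !size_tuple.
rewrite (bigD1 w)//= [X in _ + X]big1 ?addr0 => [|u uw]; rewrite sum_letters !xl_rcons !xr_rcons.
  rewrite !(negbTE (mid_neq_xl _ _ _ _))// !(negbTE (mid_neq_xr _ _ _ _))//.
  have mE c : (mid b w == mid c w) = (b == c).
    by apply/eqP/eqP => [/(mid_inj s_gt0 s_le (erefl _)) []|->].
  by rewrite !mE; case: b {mE}; rewrite /= ?addr0 ?add0r// addrC.
rewrite !(negbTE (mid_neq_xl _ _ _ (sz u)))// !(negbTE (mid_neq_xr _ _ _ (sz u)))//.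
have mE c : (mid b w == mid c u) = false.
  apply/eqP => /(mid_inj s_gt0 s_le (sz u)) [_ /val_inj e].
  by rewrite e eqxx in uw.
by rewrite !mE !addr0.
Qed.

Lemma deg_sum m x : deg m x = (\sum_(y : V m | adj s m x (val y)) 1)%N.
Proof. by rewrite /Defs.deg -sum1_card; apply: eq_bigl => y; rewrite inE. Qed.

Lemma degS m x : x \in V m -> deg m.+1 x = (2 * deg m x)%N.
Proof.
move=> xV; rewrite !deg_sum (sum_neighbours_old (fun=> 1%N) xV).
rewrite (sum_neighbours s_gt0 s_le m x (fun=> 1%N)) big_distrr /=.
by apply: eq_bigr => w _; case: (x == _); case: (x == _).
Qed.

Lemma deg_mid m b (w : m.-tuple 'I_4) : deg m.+1 (mid b w) = 2.
Proof. by rewrite deg_sum (sum_neighbours_mid b w (fun=> 1%N)). Qed.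

Definition avg m theta (f : cfun (V m) C) : cfun (V m) C :=
  [ffun x : V m => ((deg m (val x))%:R)^-1 *
     \sum_(y : V m | adj s m (val x) (val y)) f y * expi (theta (val x) (val y))].

Let degC_neq0 m (x : V m) : (deg m (val x))%:R != 0 :> C.
Proof. by rewrite pnatr_eq0 -lt0n deg_gt0// (valP x). Qed.

Lemma neg_magneticE m theta (f : cfun (V m) C) : neg_magnetic theta f = f - avg theta f.
Proof.
apply/ffunP => x; rewrite !ffunE mulNr opprK sumrB mulrBr; congr (_ - _).
rewrite sumr_const (_ : #|_| = deg m (val x)); last first.
  by rewrite /Defs.deg; apply: eq_card => y; rewrite inE.
by rewrite -[X in _ * X]mulr_natl mulKf// degC_neq0.
Qed.

Lemma neg_magnetic_linear m theta : linear (@neg_magnetic R s m theta).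
Proof.
move=> c f g; rewrite !neg_magneticE; apply/ffunP => x; rewrite !ffunE.
have -> : \sum_(y : V m | adj s m (val x) (val y))
    (c *: f + g) y * expi (theta (val x) (val y)) =
  c * (\sum_(y : V m | adj s m (val x) (val y)) f y * expi (theta (val x) (val y))) +
  \sum_(y : V m | adj s m (val x) (val y)) g y * expi (theta (val x) (val y)).
  by rewrite mulr_sumr -big_split; apply: eq_bigr => y _; rewrite !ffunE mulrDl mulrA.
by rewrite /GRing.scale /=; ring.
Qed.

(* The averaging operator is a contraction for the l^1 norm weighted by degrees. *)
Lemma magnetic_injective m theta (z : C) (f : cfun (V m) C) : 1 < `|1 - z| ->
  neg_magnetic theta f - z *: f = 0 -> f = 0.
Proof.
move=> z1 /ffunP e.
have eqn (x : V m) : `|1 - z| * ((deg m (val x))%:R * `|f x|) <=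
    \sum_(y : V m | adj s m (val x) (val y)) `|f y|.
  have := e x; rewrite neg_magneticE !ffunE => /eqP.
  rewrite addrAC subr_eq0 => /eqP.
  rewrite (_ : f x - z *: f x = (1 - z) * f x); last by rewrite mulrBl mul1r.
  move=> fx; rewrite mulrCA -normrM fx normrM normfV normr_nat mulrA divff ?mul1r//.
  apply: le_trans (ler_norm_sum _ _ _) _; apply: ler_sum => y _.
  by rewrite normrM norm_expi mulr1.
have : \sum_(x : V m) `|1 - z| * ((deg m (val x))%:R * `|f x|) <=
    \sum_(x : V m) \sum_(y : V m | adj s m (val x) (val y)) `|f y|.
  by apply: ler_sum => x _; exact: eqn.
rewrite -mulr_sumr (exchange_big_dep xpredT)//=.
have -> : \sum_(j : V m) \sum_(i : V m | adj s m (val i) (val j)) `|f j| =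
    \sum_(x : V m) (deg m (val x))%:R * `|f x|.
  apply: eq_bigr => y _; under eq_bigl do rewrite adj_sym.
  rewrite deg_sum natr_sum mulr_suml; apply: eq_bigr => x _.
  by rewrite mul1r.
set S := \sum_x _ => S1.
have S0 : 0 <= S by apply: sumr_ge0 => x _; rewrite mulr_ge0.
have {S1} : (`|1 - z| - 1) * S <= 0 by rewrite mulrBl mul1r subr_le0.
rewrite pmulr_rle0 ?subr_gt0// => S1.
have : S == 0 by rewrite eq_le S0 S1.
rewrite psumr_eq0 => [/allP Sx|x _]; last by rewrite mulr_ge0.
apply/ffunP => x; have := Sx x; rewrite mem_index_enum => /(_ isT).
by rewrite mulf_eq0 (negbTE (degC_neq0 x)) normr_eq0 ffunE => /eqP.
Qed.

Lemma neg_magnetic_neq_id m theta : exists f, @neg_magnetic R s m theta f <> f.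
Proof.
pose w := nseq_tuple m letter1.
pose a : V m := [` xl_V s w]%fset; pose b : V m := [` xr_V s w]%fset.
exists ([ffun y => (y == b)%:R] : cfun (V m) C) => /ffunP /(_ a).
rewrite neg_magneticE !ffunE => /eqP; rewrite -subr_eq0 addrC addKr oppr_eq0.
rewrite mulf_eq0 invr_eq0 (negbTE (degC_neq0 a)) /= (bigD1 b)/=; last first.
  by apply/existsP; exists w; rewrite is_edgeE// !eqxx.
rewrite big1 => [|y /andP[_ /negbTE yb]]; last by rewrite ffunE yb mul0r.
by rewrite ffunE eqxx mul1r addr0 -normr_eq0 norm_expi oner_eq0.
Qed.

End Averaging.

Section Schur.
Variables (R : realType) (s : R).
Hypotheses (s_gt0 : 0 < s) (s_le : s <= 8^-1).
Implicit Types (theta : plane R -> plane R -> R).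
Local Notation xl := (xl s).
Local Notation xr := (xr s).
Local Notation mid := (mid s).
Local Notation V := (V s).
Local Notation deg := (deg s).
Local Notation C := R[i].

Let nrm (z : C) : R := complex.Re `|z|.

Let nrmE z : `|z| = ((nrm z)%:C)%C.
Proof. by rewrite RRe_real// normr_real. Qed.

Let nrm_ge0 z : 0 <= nrm z.
Proof. by rewrite -lecR -nrmE normr_ge0. Qed.

Let hnormE m (u : cfun (V m) C) :
  hnorm (@graph_ip R s m) u = Num.sqrt (\sum_(x : V m) (deg m (val x))%:R * nrm (u x) ^+ 2).
Proof.
rewrite /hnorm; congr Num.sqrt; rewrite /graph_ip raddf_sum; apply: eq_bigr => x _.
rewrite -normCK nrmE -rmorphXn (_ : (deg m (val x))%:R = ((deg m (val x))%:R%:C)%C).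
  by rewrite -rmorphM.
by rewrite rmorph_nat.
Qed.

Let coord_le m (u : cfun (V m) C) x : nrm (u x) <= hnorm (@graph_ip R s m) u.
Proof.
rewrite hnormE -[leLHS](ger0_norm (nrm_ge0 _)) -sqrtr_sqr ler_wsqrtr//.
rewrite (bigD1 x)//=; apply: (@le_trans _ _ ((deg m (val x))%:R * nrm (u x) ^+ 2)).
  by rewrite ler_peMl ?sqr_ge0// ler1n deg_gt0// (valP x).
by rewrite lerDl sumr_ge0// => y _; rewrite mulr_ge0 ?sqr_ge0.
Qed.

Let hnorm_le m (u : cfun (V m) C) (N : R) : 0 <= N -> (forall x, nrm (u x) <= N) ->
  hnorm (@graph_ip R s m) u <= Num.sqrt (\sum_(x : V m) (deg m (val x))%:R) * N.
Proof.
move=> N0 uN; rewrite hnormE -[in leRHS](ger0_norm N0) -sqrtr_sqr -sqrtrM ?sumr_ge0//.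
rewrite ler_wsqrtr// mulr_suml; apply: ler_sum => x _.
by rewrite ler_wpM2l// lerXn2r ?nnegrE.
Qed.

Let neg_magnetic_le m theta (u : cfun (V m) C) (N : R) : (forall x, nrm (u x) <= N) ->
  forall x, nrm (neg_magnetic theta u x) <= 2 * N.
Proof.
move=> uN x; rewrite -lecR -nrmE neg_magneticE// !ffunE.
apply: le_trans (ler_normB _ _) _; rewrite rmorphM rmorph_nat mulr_natl mulr2n.
apply: lerD; first by rewrite nrmE lecR.
have d0 : (deg m (val x))%:R != 0 :> C by rewrite pnatr_eq0 -lt0n deg_gt0// (valP x).
rewrite normrM normfV normr_nat -[leRHS](mulKf d0) ler_wpM2l ?invr_ge0//.
apply: le_trans (ler_norm_sum _ _ _) _; rewrite deg_sum natr_sum mulr_suml.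
by apply: ler_sum => y _; rewrite normrM norm_expi mulr1 mul1r nrmE lecR.
Qed.

Lemma neg_magnetic_bounded m theta : bounded_op (@graph_ip R s m) (@neg_magnetic R s m theta).
Proof.
split; first exact: neg_magnetic_linear.
exists (Num.sqrt (\sum_(x : V m) (deg m (val x))%:R) * 2) => u.
rewrite -mulrA; apply: hnorm_le; first by rewrite mulr_ge0// sqrtr_ge0.
by apply: neg_magnetic_le => x; exact: coord_le.
Qed.

Definition zero_ext m (f : cfun (V m) C) (p : plane R) : C := if insub p is Some y then f y else 0.

Let zero_extE m (f : cfun (V m) C) x : zero_ext f (val x) = f x.
Proof. by rewrite /zero_ext valK. Qed.

Let zero_ext_out m (f : cfun (V m) C) p : p \notin V m -> zero_ext f p = 0.
Proof. by move=> pV; rewrite /zero_ext insubN. Qed.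

Lemma extend0E n m (f : cfun (V n) C) x : extend0 m f x = zero_ext f (val x).
Proof. by rewrite ffunE. Qed.

Lemma extend0_linear n m : linear (@extend0 R s n m).
Proof.
move=> c f g; apply/ffunP => x; rewrite !ffunE; case: insub => [y|]; rewrite ?ffunE//.
by rewrite scaler0 addr0.
Qed.

Lemma neg_magnetic_bounded_inherited n m theta : (forall x, x \in V n -> x \in V m) ->
  bounded_op (@inherited_ip R s n m) (@neg_magnetic R s n theta).
Proof.
move=> nm; split; first exact: neg_magnetic_linear.
have hE u : hnorm (@inherited_ip R s n m) u = hnorm (@graph_ip R s m) (extend0 m u) by [].
exists (Num.sqrt (\sum_(x : V m) (deg m (val x))%:R) * 2) => u.
rewrite -mulrA !hE; apply: hnorm_le; first by rewrite mulr_ge0// sqrtr_ge0.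
move=> x; rewrite extend0E; have [xV|xV] := boolP (val x \in V n); last first.
  by rewrite zero_ext_out// /nrm normr0 /= mulr_ge0// sqrtr_ge0.
rewrite (_ : val x = val [` xV]%fset)// zero_extE; apply: neg_magnetic_le => y.
apply: le_trans (coord_le _ [` nm _ (valP y)]%fset).
by rewrite extend0E (_ : val _ = val y)// zero_extE.
Qed.

Definition restr m (f : cfun (V m.+1) C) : cfun (V m) C := [ffun x : V m => zero_ext f (val x)].

Lemma restr_extend0 m (f : cfun (V m) C) : restr (extend0 m.+1 f) = f.
Proof.
apply/ffunP => x; rewrite ffunE (_ : val x = val [` V_subS (valP x)]%fset)// zero_extE extend0E.
by rewrite (_ : val _ = val x)// zero_extE.
Qed.

Lemma restr_adjoint m (f : cfun (V m) C) (g : cfun (V m.+1) C) :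
  graph_ip (extend0 m.+1 f) g = inherited_ip m.+1 f (restr g).
Proof.
apply: eq_bigr => x _; rewrite !extend0E.
have [xV|xV] := boolP (val x \in V m); last by rewrite zero_ext_out// !mul0r.
rewrite [X in zero_ext (restr g) X](_ : val x = val [` xV]%fset)// zero_extE ffunE.
by rewrite (_ : val [` xV]%fset = val x)// zero_extE.
Qed.

Section Step.
Variables (m : nat) (theta1 theta0 : plane R -> plane R -> R) (beta : R).
Hypothesis theta1N : forall w : m.+1.-tuple 'I_4,
  theta1 (xr w) (xl w) = - theta1 (xl w) (xr w).
Hypothesis theta0N : forall w : m.-tuple 'I_4,
  theta0 (xr w) (xl w) = - theta0 (xl w) (xr w).
Hypothesis theta_step : forall (w : m.-tuple 'I_4) (i : 'I_4),
  theta1 (xl (rcons w i)) (xr (rcons w i)) =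
  theta0 (xl w) (xr w) / 2 + beta * (if (i < 2)%N then - 1 else 1).

Let phase (b : bool) (w : m.-tuple 'I_4) :=
  theta0 (xl w) (xr w) / 2 + beta * (if b then - 1 else 1).

Let theta1_mid b (w : m.-tuple 'I_4) : (theta1 (xl w) (mid b w) = phase b w) *
  (theta1 (mid b w) (xr w) = phase b w) *
  (theta1 (mid b w) (xl w) = - phase b w) * (theta1 (xr w) (mid b w) = - phase b w).
Proof.
have N i : theta1 (xr (rcons w i)) (xl (rcons w i)) =
    - (theta0 (xl w) (xr w) / 2 + beta * (if (i < 2)%N then - 1 else 1)).
  by rewrite (theta1N [tuple of rcons w i]) theta_step.
have P := theta_step w.
by case: b; do !split; [move: (P letter2)|move: (P letter1)|move: (N letter2)|move: (N letter1)
  |move: (P letter3)|move: (P letter4)|move: (N letter3)|move: (N letter4)];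
  rewrite !xl_rcons !xr_rcons.
Qed.

Lemma schur_complement (z : C) (f : cfun (V m.+1) C) : z != 1 ->
  (forall x : V m.+1, val x \notin V m -> (neg_magnetic theta1 f - z *: f) x = 0) ->
  restr (neg_magnetic theta1 f - z *: f) =
  phi0 beta z *: neg_magnetic theta0 (restr f) - phi1 beta z *: restr f.
Proof.
move=> z1 f0; set c := 1 - z; have c0 : c != 0 by rewrite subr_eq0 eq_sym.
pose F := zero_ext f.
have sumF p : \sum_(y : V m.+1 | adj s m.+1 p (val y)) f y * expi (theta1 p (val y)) =
    \sum_(y : V m.+1 | adj s m.+1 p (val y)) F (val y) * expi (theta1 p (val y)).
  by apply: eq_bigr => y _; rewrite /F zero_extE.
have MfE (x : V m.+1) : (neg_magnetic theta1 f - z *: f) x = c * F (val x) -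
    ((deg m.+1 (val x))%:R)^-1 *
    \sum_(y : V m.+1 | adj s m.+1 (val x) (val y)) F (val y) * expi (theta1 (val x) (val y)).
  rewrite neg_magneticE// !ffunE sumF /F zero_extE /c /GRing.scale /=; ring.
have Fmid b (w : m.-tuple 'I_4) : c * F (mid b w) =
    (F (xl w) * expi (- phase b w) + F (xr w) * expi (phase b w)) / 2.
  have := MfE [` mid_VS s b w]%fset; rewrite f0 /=; last exact: mid_notin_V.
  rewrite (sum_neighbours_mid s_gt0 s_le b w (fun y => F y * expi (theta1 (mid b w) y))).
  rewrite deg_mid// !theta1_mid => /eqP; rewrite eq_sym subr_eq0 => /eqP ->.
  by rewrite mulrC.
pose K : C := ((cos (2 * beta))%:C)%C.
have phases (w : m.-tuple 'I_4) : expi (phase true w) * expi (phase true w) +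
    expi (phase false w) * expi (phase false w) = 2 * K * expi (theta0 (xl w) (xr w)).
  rewrite -!expiD /phase.
  rewrite (_ : _ + _ + _ = theta0 (xl w) (xr w) + - (2 * beta)); last by field.
  rewrite [X in _ + expi X](_ : _ = theta0 (xl w) (xr w) + 2 * beta); last by field.
  by rewrite !expiD -mulrDr addrC -expi_cos addrC mulrC.
have phasesN (w : m.-tuple 'I_4) : expi (- phase true w) * expi (- phase true w) +
    expi (- phase false w) * expi (- phase false w) = 2 * K * expi (theta0 (xr w) (xl w)).
  rewrite -!expiD /phase theta0N.
  rewrite (_ : _ + _ = - theta0 (xl w) (xr w) + (2 * beta)); last by field.
  rewrite [X in _ + expi X](_ : _ = - theta0 (xl w) (xr w) + - (2 * beta)); last by field.
  by rewrite !expiD -mulrDr -expi_cos mulrC.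
have unit (a : R) : expi (- a) * expi a = 1 :> C by rewrite -expiD addNr expi0.
have alg (X Y a a' b b' E : C) : a' * a = 1 -> b' * b = 1 -> a * a + b * b = 2 * K * E ->
    (X * a' + Y * a) / 2 * a + (X * b' + Y * b) / 2 * b = X + K * (Y * E).
  move=> h1 h2 h3.
  transitivity (X * (a' * a + b' * b) / 2 + Y * (a * a + b * b) / 2); first by field.
  by rewrite h1 h2 h3; field.
have turnl (w : m.-tuple 'I_4) : c * (F (mid true w) * expi (theta1 (xl w) (mid true w)) +
    F (mid false w) * expi (theta1 (xl w) (mid false w))) =
    F (xl w) + K * (F (xr w) * expi (theta0 (xl w) (xr w))).
  by rewrite !theta1_mid mulrDr ![c * (_ * _)]mulrA !Fmid; exact: alg.
have turnr (w : m.-tuple 'I_4) : c * (F (mid true w) * expi (theta1 (xr w) (mid true w)) +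
    F (mid false w) * expi (theta1 (xr w) (mid false w))) =
    F (xr w) + K * (F (xl w) * expi (theta0 (xr w) (xl w))).
  rewrite !theta1_mid mulrDr ![c * (_ * _)]mulrA !Fmid ![F (xl w) * _ + _]addrC.
  by apply: alg => //; rewrite mulrC unit.
apply/ffunP => x; have xV := valP x; pose x' := [` V_subS xV]%fset.
rewrite [neg_magnetic theta0 _]neg_magneticE// [LHS]ffunE.
rewrite (_ : val x = val x')// zero_extE MfE -[val x']/(val x) !ffunE -/F.
have sum0 : \sum_(y : V m | adj s m (val x) (val y)) restr f y * expi (theta0 (val x) (val y)) =
    \sum_(y : V m | adj s m (val x) (val y)) F (val y) * expi (theta0 (val x) (val y)).
  by apply: eq_bigr => y _; rewrite ffunE.
rewrite sum0 degS// natrM; set A := \sum_(y : V m.+1 | _) _; set B := \sum_(y : V m | _) _.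
have cA : c * A = (deg m (val x))%:R * F (val x) + K * B.
  rewrite /A (sum_neighbours_old s_gt0 s_le (fun y => F y * expi (theta1 (val x) y)))//.
  rewrite /B (sum_neighbours s_gt0 s_le m _ (fun y => F y * expi (theta0 (val x) y))).
  rewrite degE// natr_sum mulr_suml !mulr_sumr -big_split; apply: eq_bigr => w _ /=.
  have [->|_] := eqVneq (val x) (xl w).
    by rewrite (negbTE (xl_neq_xr s_gt0 w)) !addr0 turnl mul1r.
  have [->|_] := eqVneq (val x) (xr w); first by rewrite !add0r turnr mul1r.
  by rewrite !addr0 !mulr0 mul0r addr0.
have d0 : (deg m (val x))%:R != 0 :> C by rewrite pnatr_eq0 -lt0n deg_gt0.
have -> : A = ((deg m (val x))%:R * F (val x) + K * B) / c by rewrite -cA mulrC mulKf.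
rewrite /phi0 /phi1 -/K /GRing.scale /= -/c (_ : z = 1 - c); last by rewrite /c; ring.
move: (deg m (val x))%:R d0 => d d0; rewrite /F /=.
by field; rewrite c0 d0.
Qed.

Lemma spectrally_similar_step :
  spectrally_similar (@graph_ip R s m.+1) (@inherited_ip R s m m.+1) (@extend0 R s m m.+1)
    (@neg_magnetic R s m.+1 theta1) (@neg_magnetic R s m theta0)
    [set z | z != 1] (phi0 beta) (phi1 beta).
Proof.
split.
- split; first exact: neg_magnetic_bounded.
  by apply: neg_magnetic_bounded_inherited => x; exact: V_subS.
- exact: neg_magnetic_neq_id.
- by split; first exact: extend0_linear.
exists (ball (4 : C^o) 1).
have far (z : C^o) : ball (4 : C^o) 1 z -> 1 < `|1 - z|.
  rewrite -ball_normE /= => z4.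
  rewrite -(ltrD2l `|4 - z|); apply: (@lt_le_trans _ _ 3).
    rewrite (_ : 3 = 2 + 1 :> C) ?ltrD2r; last by ring.
    by apply: lt_trans z4 _; rewrite ltr1n.
  rewrite -[3](@ger0_norm C) ?ler0n// -(normrN (1 - z)).
  by apply: le_trans (ler_normD _ _); rewrite [X in _ <= `|X|](_ : _ = 3)//; ring.
split.
- exact: ball_open.
- by exists 4; exact: ballxx.
- move=> z /far; rewrite /= => z1; apply/eqP => ze; move: z1.
  by rewrite ze subrr normr0 ltr10.
move=> z /far z1; have zn1 : z != 1.
  by apply/eqP => ze; move: z1; rewrite ze subrr normr0 ltr10.
have lin1 : linear (fun u : cfun (V m.+1) C => neg_magnetic theta1 u - z *: u).
  move=> k u v.
  have := linear_pencil 1 z (@neg_magnetic_linear _ _ s_gt0 s_le _ theta1) k u v.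
  by rewrite !scale1r.
have [Rz [RzK KRz]] := linear_inj_bij lin1
  (fun u => @magnetic_injective _ _ s_gt0 s_le _ _ _ u z1).
have SK : cancel (fun u => restr (Rz (extend0 m.+1 u)))
    (fun u => phi0 beta z *: neg_magnetic theta0 u - phi1 beta z *: u).
  move=> u; rewrite -schur_complement// KRz ?restr_extend0// => x xV.
  by rewrite extend0E zero_ext_out.
exists Rz, (@restr m), (fun u => restr (Rz (extend0 m.+1 u))); split=> //.
- exact: restr_adjoint.
- split=> //.
  exact: (linear_surj_inj (linear_pencil _ _ (@neg_magnetic_linear _ _ s_gt0 s_le _ _)) SK).
Qed.

End Step.

End Schur.

Lemma edge_function_antisym (R : realType) (s : R) X (H : lmodType R[i]) tensor m (b : H) theta
    (w : m.-tuple 'I_4) :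
  0 < s -> is_edge_function s X tensor m b theta ->
  theta (xr s w) (xl s w) = - theta (xl s w) (xr s w).
Proof.
move=> s0 [A [_ _ thE]]; rewrite !(thE w) ?opprB// is_edgeE//.
  by rewrite !eqxx.
by rewrite !eqxx orbT.
Qed.

Theorem theorem4p8 (R : realType) (s : R) (hs_gt0 : 0 < s) (hs_le : s <= 8^-1)
  (X : set (plane R)) (hX : is_attractor s X)
  (H : lmodType R[i]) (ip : H -> H -> R[i])
  (tensor : (plane R -> R[i]) -> (plane R -> R[i]) -> H)
  (hH : is_oneform_space s X ip tensor)
  (a : H) (ha : real_valued s X ip tensor a)
  (a_ : nat -> H)
  (hproj : forall m, is_orth_proj ip (Hscale s X tensor m) a (a_ m))
  (theta : nat -> plane R -> plane R -> R)
  (htheta : forall m, is_edge_function s X tensor m (a_ m) (theta m))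
  (beta : nat -> R) (hflux : flux_scale_only s X tensor a_ beta) :
  forall m : nat, (1 <= m)%N ->
    spectrally_similar (@graph_ip R s m) (@inherited_ip R s m.-1 m)
      (@extend0 R s m.-1 m)
      (@neg_magnetic R s m (theta m)) (@neg_magnetic R s m.-1 (theta m.-1))
      [set z | z != 1] (phi0 (beta m)) (phi1 (beta m)).
Proof.
case=> // m _; have [k [hk ak]] := hflux m.
apply: spectrally_similar_step => // w.
- exact: edge_function_antisym (htheta m.+1).
- exact: edge_function_antisym (htheta m).
move=> i; rewrite -(sum_loop hs_gt0 hs_le w).
exact: (edge_function_step hs_gt0 hs_le hX hH w i (htheta m.+1) (htheta m) hk ak).
Qed.
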